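(* (1) UQAFO, EML, and $\max$-DENs have the same expressive power. (2) $\mathrm{sum}$-DENs are strictly more expressive than UQAFO. (3) $\mathrm{sum}$-DENs and $\mathrm{sum}$-DHNs have the same expressive power. (4) $\max$-DENs are strictly more expressive than $\max$-DHNs.
   Context: Databases. A schema $S$ is a finite set of relation symbols $R$ with arities $\mathrm{ar}(R)\ge 0$. An $S$-database $D$ is a finite set of facts $R(\bar v)$, $R\in S$, $\bar v$ an $\mathrm{ar}(R)$-tuple of values from a fixed countably infinite set; $\mathrm{adom}(D)$ is the set of values occurring in $D$. A pointed database $D^v$ is a database with $v\in\mathrm{adom}(D)$. A pattern $F$ is a database together with a finite set $\mathrm{adom}(F)$ of values containing all values occurring in its facts (isolated values allowed); $F^w$ is a pattern with distinguished $w\in\mathrm{adom}(F)$. $\mathrm{Hom}(F^w,D^u)$ is the set of maps $h:\mathrm{adom}(F)\to\mathrm{adom}(D)$ with $h(w)=u$ and $R(\bar v)\in F\Rightarrow R(h(\bar v))\in D$. An embedding is an injective such homomorphism with additionally $R(h(\bar v))\in D\Rightarrow R(\bar v)\in F$ for all tuples $\bar v$ over $\mathrm{adom}(F)$. DHNs and DENs. An aggregation function maps finite multisets of reals to reals (e.g. sum, max, with $\max(\emptyset)=0$); applied to vectors component-wise. A homomorphism query of input dimension $d\ge 0$ and output dimension $d'>0$ is a triple $(F^w,\mu,\mathrm{agg})$, $F^w$ a pointed pattern, $\mu$ assigning to each $v\in\mathrm{adom}(F)$ a transformation function $\mu_v:\mathbb R^d\to\mathbb R^{d'}$, $\mathrm{agg}$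 an aggregation function. On $D^u$ with vector labeling $\lambda:\mathrm{adom}(D)\to\mathbb R^d$ its result is $\mathrm{agg}\{\!\{\prod_{v\in\mathrm{adom}(F)}\mu_v(\lambda(h(v)))\mid h\in\mathrm{Hom}(F^w,D^u)\}\!\}$ (component-wise product). A DHN layer is a finite sequence of homomorphism queries of the same input dimension, with output dimensions $d_1,\dots,d_m$, and a combination function $\mathrm{com}:\mathbb R^{d_1}\times\dots\times\mathbb R^{d_m}\to\mathbb R^{d'}$; it maps $\lambda$ to the labeling sending $u$ to $\mathrm{com}$ applied to the results of the queries on $(D^u,\lambda)$. A DHN over $S$ is a sequence $(\mathcal L_1,\dots,\mathcal L_k,\mathrm{cls})$ of layers with matching dimensions, input dimension of $\mathcal L_1$ equal to $0$, and a classification function $\mathrm{cls}:\mathbb R^{d'}\to\{0,1\}$. Starting from the empty-vector labeling, apply the layers in order to get $\lambda^k$; the DHN accepts $D^v$ iff $\mathrm{cls}(\lambda^k(v))=1$. All these functions are arbitrary. An agg-DHN uses only the aggregation function agg. DENs (deep embedding networks) and agg-DENs are defined identically except that $\mathrm{Hom}(F^w,D^u)$ is replaced by the set of embeddings from $F^w$ to $D^u$. Logics (quantifiers range over $\mathrm{adom}(D)$; used as classifiers via formulas with one free variable). UQAFO: with $\circ\in\{\vee,\wedge\}$, $\varphi(\bar x)::=\varphi_\exists(\bar x)\mid\varphi_\forall(\bar x)\mid\varphi(\bar x)\circ\varphi(\bar x)$; $\varphi_\exists(\bar x)::=R(\bar x)\mid\neg R(\bar x)\mid\varphi_\exists(\bar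 x)\circ\varphi_\exists(\bar x)\mid x_i=x_j\mid x_i\ne x_j\mid\exists\bar y\,\varphi_\exists(\bar x,\bar y)\mid\varphi_\forall(x_i)$; $\varphi_\forall(\bar x)::=R(\bar x)\mid\neg R(\bar x)\mid\varphi_\forall(\bar x)\circ\varphi_\forall(\bar x)\mid x_i=x_j\mid x_i\ne x_j\mid\forall\bar y\,\varphi_\forall(\bar x,\bar y)\mid\varphi_\exists(x_i)$ (in the last alternatives the formula has at most the free variable $x_i$). EML: $\varphi(x)::=\neg\varphi(x)\mid\varphi(x)\vee\varphi(x)\mid\exists\bar y\,\psi(x,\bar y)$, where $\psi$ is a conjunction of relational atoms $R(\bar z)$, negated relational atoms $\neg R(\bar z)$, inequalities $z_1\ne z_2$, and EML formulas $\varphi(z)$ with one free variable, all over the variables $x,\bar y$. Expressive power. A classifier over $S$ expresses the set of pointed $S$-databases $D^v$ it accepts (a formula accepts $D^v$ iff $D\models\varphi(v)$). $\mathcal C_2$ is at least as expressive as $\mathcal C_1$ if every property (over any schema) expressible by a member of $\mathcal C_1$ is expressible by a member of $\mathcal C_2$; same expressive power: both directions; strictly more expressive: at least as expressive, and for some schema some property expressible in $\mathcal C_2$ is not expressible in $\mathcal C_1$. *)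

(* Defs.v *)
From HB Require Import structures.
From mathcomp Require Import all_boot all_order all_algebra.
From mathcomp Require Import finmap multiset reals.

Set Implicit Arguments.
Unset Strict Implicit.
Unset Printing Implicit Defensive.

Import Order.TTheory GRing.Theory Num.Theory.

Local Open Scope fset_scope.
Local Open Scope ring_scope.

Record schema := Schema { sym :> finType; ar : sym -> nat }.

(* The fixed countably infinite set of values is nat. *)
Definition fact (S : schema) := {r : S & (ar r).-tuple nat}.

Definition mkfact (S : schema) (r : S) (t : (ar r).-tuple nat) : fact S :=
  Tagged (fun r : S => (ar r).-tuple nat) t.

Definition database (S : schema) := {fset fact S}.

Definition adom (S : schema) (D : database S) : {fset nat} :=
  \bigcup_(f <- D) [fset x in val (tagged f)].

Record pointed_db (S : schema) := PointedDb {
  db : database S;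
  pt : adom db }.

Record pattern (S : schema) := Pattern {
  pfacts : database S;
  pdom : {fset nat};
  adom_sub_pdom : adom pfacts `<=` pdom }.

Definition homs (S : schema) (F : pattern S) (w : pdom F)
    (D : database S) (u : adom D) : {set {ffun pdom F -> adom D}} :=
  [set h : {ffun pdom F -> adom D} | (h w == u) &&
    [forall r : S, forall t : (ar r).-tuple (pdom F),
      (mkfact (map_tuple val t) \in pfacts F) ==>
      (mkfact (map_tuple (fun v => val (h v)) t) \in D)]].

Definition embs (S : schema) (F : pattern S) (w : pdom F)
    (D : database S) (u : adom D) : {set {ffun pdom F -> adom D}} :=
  [set h in homs w u | injectiveb h &&
    [forall r : S, forall t : (ar r).-tuple (pdom F),
      (mkfact (map_tuple (fun v => val (h v)) t) \in D) ==>
      (mkfact (map_tuple val t) \in pfacts F)]].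

Definition aggregation (R : realType) := {mset R}%mset -> R.

Definition agg_sum (R : realType) : aggregation R :=
  fun A => \sum_(x <- A) x.

(* The maximum of a nonempty multiset may be negative, so 0 is used only as
   the value on the empty multiset, not as the unit of the iterated max. *)
Definition agg_max (R : realType) : aggregation R :=
  fun A => if (A : seq R) is x :: s then \big[Num.max/x]_(y <- s) y else 0.

Record query (R : realType) (S : schema) (d d' : nat) := Query {
  qpat : pattern S;
  qroot : pdom qpat;
  qmu : pdom qpat -> 'rV[R]_d -> 'rV[R]_d';
  qagg : aggregation R }.

Record layer (R : realType) (S : schema) (d d' : nat) := Layer {
  nq : nat;
  qdim : 'I_nq -> nat;
  qdim_gt0 : forall i, (0 < qdim i)%N;
  lquery : forall i, query R S d (qdim i);
  com : (forall i, 'rV[R]_(qdim i)) -> 'rV[R]_d' }.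

Arguments qdim {R S d d'} l i.
Arguments lquery {R S d d'} l i.
Arguments com {R S d d'} l _.

(* [network R S d]: sequences of layers with matching dimensions and input
   dimension d, ended by a classification function. *)
Inductive network (R : realType) (S : schema) : nat -> Type :=
| NCls d (cls : 'rV[R]_d -> bool) : network R S d
| NLayer d d' (L : layer R S d d') (N : network R S d') : network R S d.

Fixpoint uses_only (R : realType) (S : schema) (agg : aggregation R)
    (d : nat) (N : network R S d) : Prop :=
  match N with
  | NCls _ _ => True
  | NLayer _ _ L N' =>
      (forall i : 'I_(nq L), qagg (lquery L i) = agg) /\ uses_only agg N'
  end.

(* The networks of both kinds have the same syntax; [maps], instantiated with
   [homs] or with [embs], is the set of maps the queries aggregate over. *)
Definition map_family := forall (S : schema) (F : pattern S) (w : pdom F)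
  (D : database S) (u : adom D), {set {ffun pdom F -> adom D}}.

Definition query_result (maps : map_family) (R : realType) (S : schema)
    (d d' : nat) (q : query R S d d') (D : database S)
    (lam : adom D -> 'rV[R]_d) (u : adom D) : 'rV[R]_d' :=
  \row_(j < d') qagg q (seq_mset
    [seq \prod_(v : pdom (qpat q)) qmu v (lam (h v)) 0 j
       | h : {ffun pdom (qpat q) -> adom D} in maps S (qpat q) (qroot q) D u]).

Definition layer_result (maps : map_family) (R : realType) (S : schema)
    (d d' : nat) (L : layer R S d d') (D : database S)
    (lam : adom D -> 'rV[R]_d) : adom D -> 'rV[R]_d' :=
  fun u => com L (fun i : 'I_(nq L) => query_result maps (lquery L i) lam u).

Fixpoint run (maps : map_family) (R : realType) (S : schema) (d : nat)
    (N : network R S d) (D : database S) :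
    (adom D -> 'rV[R]_d) -> adom D -> bool :=
  match N in network _ _ d return (adom D -> 'rV[R]_d) -> adom D -> bool with
  | NCls _ cls => fun lam v => cls (lam v)
  | NLayer _ _ L N' => fun lam => run maps N' (layer_result maps L lam)
  end.

(* [0 : 'rV_0] is the empty vector. *)
Definition naccepts (maps : map_family) (R : realType) (S : schema)
    (N : network R S 0) (Dv : pointed_db S) : bool :=
  run maps N (fun _ => 0) (pt Dv).

Inductive fo (S : schema) : Type :=
| Atom (r : S) (z : (ar r).-tuple nat)
| Eql (x y : nat)
| Neg (f : fo S)
| And (f g : fo S)
| Or (f g : fo S)
| Ex (y : nat) (f : fo S)
| All (y : nat) (f : fo S).

Arguments Eql {S} x y.

Fixpoint fv (S : schema) (f : fo S) : seq nat :=
  match f with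
  | Atom _ z => z
  | Eql x y => [:: x; y]
  | Neg f => fv f
  | And f g | Or f g => fv f ++ fv g
  | Ex y f | All y f => [seq x <- fv f | x != y]
  end.

Definition upd (T : Type) (a : nat -> T) (y : nat) (u : T) : nat -> T :=
  fun x => if x == y then u else a x.

Fixpoint sat (S : schema) (D : database S) (a : nat -> adom D) (f : fo S) :
    bool :=
  match f with
  | Atom _ z => mkfact (map_tuple (fun x => val (a x)) z) \in D
  | Eql x y => a x == a y
  | Neg f => ~~ sat a f
  | And f g => sat a f && sat a g
  | Or f g => sat a f || sat a g
  | Ex y f => [exists u : adom D, sat (upd a y u) f]
  | All y f => [forall u : adom D, sat (upd a y u) f]
  end.

Definition fv_in (S : schema) (x : nat) (f : fo S) : Prop :=
  {subset fv f <= [:: x]}.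

(* Quantifier blocks arise by iterating the one-variable rules. *)
Inductive uq_ex (S : schema) : fo S -> Prop :=
| ueAtom r z : uq_ex (@Atom S r z)
| ueNAtom r z : uq_ex (Neg (@Atom S r z))
| ueAnd f g : uq_ex f -> uq_ex g -> uq_ex (And f g)
| ueOr f g : uq_ex f -> uq_ex g -> uq_ex (Or f g)
| ueEq x y : uq_ex (Eql x y)
| ueNeq x y : uq_ex (Neg (Eql x y))
| ueEx y f : uq_ex f -> uq_ex (Ex y f)
| ueAll1 x f : uq_all f -> fv_in x f -> uq_ex f
with uq_all (S : schema) : fo S -> Prop :=
| uaAtom r z : uq_all (@Atom S r z)
| uaNAtom r z : uq_all (Neg (@Atom S r z))
| uaAnd f g : uq_all f -> uq_all g -> uq_all (And f g)
| uaOr f g : uq_all f -> uq_all g -> uq_all (Or f g)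
| uaEq x y : uq_all (Eql x y)
| uaNeq x y : uq_all (Neg (Eql x y))
| uaAll y f : uq_all f -> uq_all (All y f)
| uaEx1 x f : uq_ex f -> fv_in x f -> uq_all f.

Inductive uqafo (S : schema) : fo S -> Prop :=
| uqEx f : uq_ex f -> uqafo f
| uqAll f : uq_all f -> uqafo f
| uqAnd f g : uqafo f -> uqafo g -> uqafo (And f g)
| uqOr f g : uqafo f -> uqafo g -> uqafo (Or f g).

(* [eml x f]: f is an EML formula with free variable x;
   [eml_conj zs f]: f is one of the conjunctions allowed under the quantifier
   block, over the variables zs. *)
Inductive eml (S : schema) : nat -> fo S -> Prop :=
| emNeg x f : eml x f -> eml x (Neg f)
| emOr x f g : eml x f -> eml x g -> eml x (Or f g)
| emEx x (ys : seq nat) f : eml_conj (x :: ys) f ->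
    eml x (foldr (@Ex S) f ys)
with eml_conj (S : schema) : seq nat -> fo S -> Prop :=
| ecAtom zs r (z : (ar r).-tuple nat) : {subset z <= zs} ->
    eml_conj zs (@Atom S r z)
| ecNAtom zs r (z : (ar r).-tuple nat) : {subset z <= zs} ->
    eml_conj zs (Neg (@Atom S r z))
| ecNeq zs z1 z2 : z1 \in zs -> z2 \in zs -> eml_conj zs (Neg (Eql z1 z2))
| ecSub zs z f : z \in zs -> eml z f -> eml_conj zs f
| ecAnd zs f g : eml_conj zs f -> eml_conj zs g -> eml_conj zs (And f g).

Record classifiers := Classifiers {
  member : schema -> Type;
  accepts : forall S : schema, member S -> pointed_db S -> bool }.

Definition expressible (C : classifiers) (S : schema)
    (P : pointed_db S -> Prop) : Prop :=
  exists c : member C S, forall Dv : pointed_db S, accepts c Dv <-> P Dv.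

Definition at_least_as_expressive (C2 C1 : classifiers) : Prop :=
  forall (S : schema) (P : pointed_db S -> Prop),
    expressible C1 P -> expressible C2 P.

Definition same_expressive_power (C1 C2 : classifiers) : Prop :=
  at_least_as_expressive C1 C2 /\ at_least_as_expressive C2 C1.

Definition strictly_more_expressive (C2 C1 : classifiers) : Prop :=
  at_least_as_expressive C2 C1 /\
  exists (S : schema) (P : pointed_db S -> Prop),
    expressible C2 P /\ ~ expressible C1 P.

(* A formula with one free variable is evaluated under the constant
   assignment, which in particular sends that variable to the distinguished
   value. *)
Definition faccepts (S : schema) (f : fo S) (Dv : pointed_db S) : bool :=
  sat (fun _ => pt Dv) f.

Definition UQAFO : classifiers := @Classifiers
  (fun S => {f : fo S | uqafo f /\ exists x, fv_in x f})
  (fun S f => faccepts (sval f)).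

Definition EML : classifiers := @Classifiers
  (fun S => {f : fo S | exists x, eml x f})
  (fun S f => faccepts (sval f)).

Definition DHN (R : realType) (agg : aggregation R) : classifiers :=
  @Classifiers
    (fun S => {N : network R S 0 | uses_only agg N})
    (fun S N => naccepts homs (sval N)).

Definition DEN (R : realType) (agg : aggregation R) : classifiers :=
  @Classifiers
    (fun S => {N : network R S 0 | uses_only agg N})
    (fun S N => naccepts embs (sval N)).

(* Main.v *)
(* All classes other than the sum-networks are compared with embedding modal
   formulas: Boolean combinations of "there is an embedding of F^w at u whose
   images satisfy given formulas".

   - A UQAFO formula reduces to them because the truth of an existential formula
     is witnessed by a set of elements of bounded size, so that it is a finite
     disjunction over the isomorphism types of labelled structures of that size.
   - A max-network (over homomorphisms or embeddings) only ever produces labels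
     that are functions of finitely many such formulas, since a maximum depends
     only on which labelled maps exist.
   - Conversely a network can evaluate such a formula bottom-up, for any
     aggregation function that detects a 1 among values in {0, 1}.

   For sums, a homomorphism query is the sum of the embedding queries of the
   types (kernel, facts that hold) of maps; and an embedding query is a linear
   combination of homomorphism queries, by inclusion-exclusion on the negative
   conditions.

   Both separations use bare finite sets: embedding modal formulas are constant
   on all large sets while sums detect parity, and max over homomorphisms does
   not distinguish any two nonempty sets. *)

From HB Require Import structures.
From mathcomp Require Import all_boot all_order perm all_algebra.
From mathcomp Require Import finmap multiset boolp reals.
Require Import Defs.

Set Implicit Arguments.
Unset Strict Implicit.
Unset Printing Implicit Defensive.

Import Order.TTheory GRing.Theory Num.Theory.

Local Open Scope fset_scope.
Local Open Scope ring_scope.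

(** * Facts and patterns *)

Section Facts.
Variable S : schema.

(** Facts over an arbitrary type of vertices. For [nat] this is [fact S] up to conversion; for a
    finite [V] it is finite, so sets of facts over [V] can be formed. *)
Definition vfact (V : Type) : Type := {r : S & (ar r).-tuple V}.
HB.instance Definition _ (V : finType) := Finite.on (vfact V).

Definition relabel (V W : Type) (k : V -> W) (f : vfact V) : vfact W :=
  Tagged (fun r : S => (ar r).-tuple W) (map_tuple k (tagged f)).

Lemma relabel_comp (U V W : Type) (k : V -> W) (k' : U -> V) (f : vfact U) :
  relabel k (relabel k' f) = relabel (k \o k') f.
Proof.
case: f => r t; rewrite /relabel /=; congr (Tagged _ _).
by apply: val_inj; rewrite /= -map_comp.
Qed.

Lemma eq_relabel (V : eqType) (W : Type) (k k' : V -> W) (f : vfact V) :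
  {in tagged f, k =1 k'} -> relabel k f = relabel k' f.
Proof.
case: f => r t /= kk'; rewrite /relabel /=; congr (Tagged _ _).
by apply: val_inj; apply/eq_in_map.
Qed.

Lemma relabel_inj (V W : Type) (k : V -> W) : injective k -> injective (relabel k).
Proof.
move=> k_inj [r t] [r' t']; rewrite /relabel /= => e.
have er : r = r' by apply: (congr1 tag e).
case: _ / er t' e => t' e; congr (Tagged _ _).
have {}e : map_tuple k t = map_tuple k t' by exact: (eq_from_Tagged e).
by apply: val_inj; apply: (inj_map k_inj); exact: (congr1 val e).
Qed.

Definition fholds (V : Type) (D : database S) (h : V -> adom D) (f : vfact V) :
  bool := (relabel (fun v => val (h v)) f : fact S) \in D.

Lemma fholds_relabel (U V : Type) (D : database S) (k : U -> V) (h : V -> adom D) f :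
  fholds h (relabel k f) = fholds (h \o k) f.
Proof. by rewrite /fholds relabel_comp. Qed.

Lemma eq_fholds (V : eqType) (D : database S) (h h' : V -> adom D) (f : vfact V) :
  {in tagged f, h =1 h'} -> fholds h f = fholds h' f.
Proof. by move=> e; rewrite /fholds (@eq_relabel _ _ _ (fun v => val (h' v))) // => v /e ->. Qed.

Definition pholds (F : pattern S) (f : vfact (pdom F)) : bool :=
  (relabel val f : fact S) \in pfacts F.

Lemma homsP (F : pattern S) (w : pdom F) (D : database S) (u : adom D)
    (h : {ffun pdom F -> adom D}) :
  reflect (h w = u /\ forall f, pholds f -> fholds h f) (h \in homs w u).
Proof.
rewrite inE; apply: (iffP andP) => [[/eqP hw /forallP H]|[hw H]].
  split=> // -[r t]; move/forallP/(_ t)/implyP: (H r); exact.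
split; first exact/eqP.
by apply/forallP => r; apply/forallP => t; apply/implyP => /(H (existT _ r t)).
Qed.

Lemma embsP (F : pattern S) (w : pdom F) (D : database S) (u : adom D)
    (h : {ffun pdom F -> adom D}) :
  reflect [/\ h w = u, injective h & forall f, pholds f = fholds h f]
    (h \in embs w u).
Proof.
rewrite inE; apply: (iffP and3P) => [[/homsP[hw H] /injectiveP ? /forallP H']|[hw ? H]].
  split=> // f; apply/idP/idP; first exact: H.
  by case: f => r t; move/forallP/(_ t)/implyP: (H' r); exact.
split; [|exact/injectiveP|].
  by apply/homsP; split=> // f; rewrite H.
apply/forallP => r; apply/forallP => t; apply/implyP => /= Ht.
by have := H (existT _ r t); rewrite /fholds /pholds /relabel /= => ->.
Qed.

Lemma mem_adom (D : database S) (x : nat) :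
  reflect (exists2 f : vfact nat, (f : fact S) \in D & x \in val (tagged f))
    (x \in adom D).
Proof.
apply: (iffP (bigfcupP _ _ _ _)) => [[f]|[f fD xf]].
  by rewrite andbT => fD; rewrite in_fset => xf; exists f.
by exists f; rewrite ?andbT // in_fset.
Qed.

Section Generated.
(* The pattern with domain the image of [j]; a non-injective [j] gives a
   quotient of the vertex set [V]. *)
Variables (V : finType) (j : V -> nat) (T : {set vfact V}).

Definition pat_facts : database S := [fset (relabel j f : fact S) | f in T].
Definition pat_dom : {fset nat} := [fset j v | v in V].

Lemma pat_subproof : adom pat_facts `<=` pat_dom.
Proof.
apply/fsubsetP => x /mem_adom[f /imfsetP[f0 /= f0T ->]] /mapP[v _ ->].
by rewrite in_imfset.
Qed.
Definition pat : pattern S := Pattern pat_subproof.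

Lemma vert_subproof v : j v \in pat_dom.
Proof. by rewrite in_imfset. Qed.
Definition vert (v : V) : pdom pat := [` vert_subproof v].

Lemma vert_surj (x : pdom pat) : exists v, vert v = x.
Proof.
case: x => x xp; have /imfsetP[v _ xE] := xp.
by exists v; apply: val_inj; rewrite /= xE.
Qed.

(** As [j] may identify vertices, a fact of the pattern determines its source in [T] only up to
    relabelling along [vert]. *)
Lemma pholds_vert (f : vfact V) :
  pholds (relabel vert f) = [exists f0 in T, relabel vert f0 == relabel vert f].
Proof.
rewrite /pholds relabel_comp; apply/imfsetP/exists_inP => -[f0 f0T e]; exists f0 => //.
  apply/eqP/(relabel_inj val_inj); rewrite !relabel_comp; exact/esym.
by have /= := congr1 (relabel val) (eqP e); rewrite !relabel_comp.
Qed.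

Lemma vert_lift (f : vfact (pdom pat)) : exists f0, f = relabel vert f0.
Proof.
have [s sK] := choice vert_surj.
exists (relabel s f); rewrite relabel_comp /=; case: f => r t.
rewrite /relabel /=; congr (Tagged _ _); apply: val_inj => /=.
by rewrite (@eq_map _ _ _ id) ?map_id // => x; rewrite /= sK.
Qed.

Lemma homs_pat (w : V) (D : database S) (u : adom D)
    (h : {ffun pdom pat -> adom D}) :
  reflect (h (vert w) = u /\ forall f, f \in T -> fholds (h \o vert) f)
    (h \in homs (vert w) u).
Proof.
apply: (iffP (homsP _ _ _)) => -[hw H]; split=> // f.
  move=> fT; rewrite -fholds_relabel; apply: H.
  by rewrite pholds_vert; apply/exists_inP; exists f.
have [f0 ->] := vert_lift f; rewrite pholds_vert => /exists_inP[f1 f1T /eqP <-].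
by rewrite fholds_relabel H.
Qed.

Lemma embs_pat (w : V) (D : database S) (u : adom D)
    (h : {ffun pdom pat -> adom D}) :
  reflect [/\ h (vert w) = u, injective h &
      forall f, [exists f0 in T, relabel vert f0 == relabel vert f] = fholds (h \o vert) f]
    (h \in embs (vert w) u).
Proof.
apply: (iffP (embsP _ _ _)) => -[hw hi H]; split=> // f.
  by rewrite -pholds_vert H fholds_relabel.
by have [f0 ->] := vert_lift f; rewrite pholds_vert H fholds_relabel.
Qed.

End Generated.
End Facts.

(** * Types of maps *)

Section Kernel.
Variables (V : finType).

(** The relation [h v = h v'] coded as an element of a finite type: [pick] depends only on the
    predicate, so it selects one representative per class. The default [v] is never reached. *)
Definition kernel (A : eqType) (h : V -> A) : {ffun V -> V} :=
  [ffun v => odflt v [pick v' | h v' == h v]].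

Lemma kernel_val (A : eqType) (h : V -> A) v : h (kernel h v) = h v.
Proof. by rewrite ffunE; case: pickP => //= v' /eqP. Qed.

Lemma kernelP (A : eqType) (h : V -> A) v v' :
  kernel h v = kernel h v' <-> h v = h v'.
Proof.
split=> [e|e]; first by rewrite -(kernel_val h v) e kernel_val.
rewrite !ffunE (@eq_pick _ _ (fun x => h x == h v')) => [|x]; last by rewrite e.
by case: pickP => //= /(_ v'); rewrite eqxx.
Qed.

Lemma eq_kernel (A B : eqType) (h : V -> A) (k : V -> B) :
  (forall v v', h v = h v' <-> k v = k v') -> kernel h = kernel k.
Proof.
move=> hk; apply/ffunP => v; rewrite !ffunE.
rewrite (@eq_pick _ _ (fun x => k x == k v)) => [|x]; last first.
  by apply/eqP/eqP => /hk.
by case: pickP => //= /(_ v); rewrite eqxx.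
Qed.

End Kernel.

Section Diagram.
Variable S : schema.

Definition diagram (V : finType) (D : database S) (h : V -> adom D) :
  {set vfact S V} := [set f | fholds h f].

Section Quotient.
Variables (V : finType) (j : V -> nat) (s : {ffun V -> V}) (T : {set vfact S V}).
Hypothesis j_inj : injective j.
Let Q := pat (j \o s) T.
Let q : V -> pdom Q := @vert S V (j \o s) T.

Lemma vert_quotE v v' : q v = q v' <-> s v = s v'.
Proof.
by split=> [/(congr1 val) /= /j_inj //|e]; apply: val_inj; rewrite /= e.
Qed.

(** [h] factors through the quotient of [V] by its kernel. The factor is injective, and it reflects
    facts because [T] lists every fact true under [h]. *)
Lemma emb_of_type (D : database S) (h : V -> adom D) (w : V) :
  kernel h = s -> diagram h = T ->
  exists2 h' : {ffun pdom Q -> adom D},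
    h' \in embs (q w) (h w) & forall v, h' (q v) = h v.
Proof.
move=> hs hT; have [s0 s0K] := choice (@vert_surj S V (j \o s) T).
have qE v v' : q v = q v' -> h v = h v'.
  by move/vert_quotE; rewrite -hs => /kernelP.
have h'E v : [ffun x => h (s0 x)] (q v) = h v by rewrite ffunE; apply/qE/s0K.
exists [ffun x => h (s0 x)] => //; apply/embs_pat; split=> [||f].
- exact: h'E.
- move=> x y; rewrite !ffunE => e; rewrite -(s0K x) -(s0K y).
  by apply/vert_quotE; rewrite -hs; apply/kernelP.
have hE g : fholds ([ffun x => h (s0 x)] \o q) g = fholds h g.
  by apply: eq_fholds => v _; exact: h'E.
rewrite hE; apply/exists_inP/idP => [[f0 f0T /eqP e]|hf].
  rewrite -hE -fholds_relabel -e fholds_relabel hE.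
  by move: f0T; rewrite -hT inE.
by exists f; rewrite ?eqxx // -hT inE.
Qed.

(** The realisation [h0] makes [T] closed under exchanging [s]-equivalent vertices; otherwise the
    diagram of the composite could exceed [T]. *)
Lemma type_of_emb (D0 : database S) (h0 : V -> adom D0) (D : database S)
    (u : adom D) (w : V) (h' : {ffun pdom Q -> adom D}) :
  kernel h0 = s -> diagram h0 = T -> h' \in embs (q w) u ->
  kernel (h' \o q) = s /\ diagram (h' \o q) = T.
Proof.
move=> hs hT /embs_pat[_ hi H].
have qE v v' : q v = q v' <-> h0 v = h0 v'.
  by rewrite vert_quotE -hs; exact: kernelP.
split.
  rewrite -hs; apply: eq_kernel => v v'; rewrite /= -qE.
  by split=> [/hi|->].
apply/setP => f; rewrite inE -H; apply/exists_inP/idP => [[f0 f0T /eqP e]|fT].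
  2: by exists f; rewrite ?eqxx.
have [s0 s0K] := choice (@vert_surj S V (j \o s) T).
(* [h0] factors through [q], so the truth of a fact under [h0] depends only on its image under
   [q]. *)
have h0E g : fholds h0 g = fholds (h0 \o s0) (relabel q g).
  by rewrite fholds_relabel; apply: eq_fholds => v _ /=; exact/qE/esym/s0K.
rewrite -hT inE h0E -e -h0E; by move: f0T; rewrite -hT inE.
Qed.

Lemma emb_quotient_hom (D : database S) (u : adom D) (w : V)
    (h' : {ffun pdom Q -> adom D}) f :
  h' \in embs (q w) u -> f \in T -> fholds (h' \o q) f.
Proof.
by move=> /embs_pat[_ _ H] fT; rewrite -H; apply/exists_inP; exists f.
Qed.

End Quotient.
End Diagram.

(** * Embedding modal formulas *)

Section EmbeddingFormulas.
Variable S : schema.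

Inductive emf : Type :=
| ETrue
| ENot (e : emf)
| EOr (e1 e2 : emf)
| EEmb (F : pattern S) (w : pdom F) (l : pdom F -> emf).

Fixpoint esat (D : database S) (u : adom D) (e : emf) : bool :=
  match e with
  | ETrue => true
  | ENot e => ~~ esat u e
  | EOr e1 e2 => esat u e1 || esat u e2
  | EEmb F w l => [exists h in embs w u, [forall v, esat (h v) (l v)]]
  end.

Definition emdef (P : forall D : database S, adom D -> Prop) : Prop :=
  exists e, forall D (u : adom D), esat u e <-> P D u.

Lemma emdef_ext (P Q : forall D : database S, adom D -> Prop) :
  (forall D u, P D u <-> Q D u) -> emdef P -> emdef Q.
Proof. by move=> PQ [e eP]; exists e => D u; rewrite eP. Qed.

Lemma emdef_not (P : forall D : database S, adom D -> Prop) :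
  emdef P -> emdef (fun D u => ~ P D u).
Proof.
by move=> [e eP]; exists (ENot e) => D u /=; rewrite -eP; split=> /negP.
Qed.

(** Admits side conditions that do not mention the database, even undecidable ones: excluded middle
    selects the formula. *)
Lemma emdef_const (Q : Prop) : emdef (fun D u => Q).
Proof.
case: (EM Q) => HQ; first by exists ETrue.
by exists (ENot ETrue) => D u; split.
Qed.

Lemma emdef_or (P Q : forall D : database S, adom D -> Prop) :
  emdef P -> emdef Q -> emdef (fun D u => P D u \/ Q D u).
Proof.
move=> [e eP] [e' eQ]; exists (EOr e e') => D u /=; rewrite -eP -eQ.
by split=> /orP.
Qed.

Lemma emdef_exists (I : finType) (P : I -> forall D : database S, adom D -> Prop) :
  (forall i, emdef (P i)) -> emdef (fun D u => exists i, P i D u).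
Proof.
move=> Pdef.
suff H (s : seq I) : emdef (fun D u => exists2 i, i \in s & P i D u).
  apply: emdef_ext (H (enum I)) => D u; split=> [[i _ Pi]|[i Pi]]; exists i => //.
  by rewrite mem_enum.
elim: s => [|i s IH]; first by apply: emdef_ext (emdef_const False) => D u; split=> // -[].
apply: emdef_ext (emdef_or (Pdef i) IH) => D u; split.
  by case=> [Pi|[k ks Pk]]; [exists i|exists k]; rewrite // inE ?eqxx ?ks ?orbT.
by case=> k; rewrite inE => /predU1P[->|ks] Pk; [left|right; exists k].
Qed.

Lemma emdef_forall (I : finType) (P : I -> forall D : database S, adom D -> Prop) :
  (forall i, emdef (P i)) -> emdef (fun D u => forall i, P i D u).
Proof.
move=> Pdef.
have := emdef_not (emdef_exists (fun i => emdef_not (Pdef i))).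
apply: emdef_ext => D u; split=> [H i|H [i]]; last exact.
by apply: contrapT => nP; apply: H; exists i.
Qed.

Lemma emdef_and (P Q : forall D : database S, adom D -> Prop) :
  emdef P -> emdef Q -> emdef (fun D u => P D u /\ Q D u).
Proof.
move=> dP dQ; apply: emdef_ext (@emdef_forall bool (fun b => if b then P else Q) _).
  by move=> D u; split=> [H|[p q] []] //; split; [exact: (H true)|exact: (H false)].
by case.
Qed.

Lemma emdef_emb (F : pattern S) (w : pdom F)
    (P : pdom F -> forall D : database S, adom D -> Prop) :
  (forall v, emdef (P v)) ->
  emdef (fun D u => exists2 h : {ffun pdom F -> adom D},
    h \in embs w u & forall v, P v D (h v)).
Proof.
move=> /choice[l lP]; exists (EEmb w l) => D u /=; split.
  by move/exists_inP=> [h hE /forallP H]; exists h => // v; apply/lP.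
move=> [h hE H]; apply/exists_inP; exists h => //; apply/forallP => v.
exact/lP.
Qed.

(** A homomorphism is an embedding of some quotient whose facts [T] include those of [F]. A merged
    vertex must meet the conditions of all its preimages. *)
Lemma emdef_hom (F : pattern S) (w : pdom F)
    (P : pdom F -> forall D : database S, adom D -> Prop) :
  (forall v, emdef (P v)) ->
  emdef (fun D u => exists2 h : {ffun pdom F -> adom D},
    h \in homs w u & forall v, P v D (h v)).
Proof.
move=> Pdef; pose V : finType := pdom F.
pose q (sT : {ffun V -> V} * {set vfact S V}) := @vert S V (val \o sT.1) sT.2.
have H := @emdef_exists ({ffun V -> V} * {set vfact S V})%type (fun sT D u =>
   (forall f, pholds f -> f \in sT.2) /\
   exists2 h : {ffun pdom (pat (val \o sT.1) sT.2) -> adom D},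
     h \in embs (q sT w) u & forall x v, q sT v = x -> P v D (h x)).
apply: emdef_ext (H _) => {H} [D u|sT]; last first.
  apply: emdef_and; first exact: emdef_const.
  apply: (@emdef_emb _ _ (fun x D u' => forall v, q sT v = x -> P v D u')) => x.
  apply: (@emdef_forall V (fun v D u' => q sT v = x -> P v D u')) => v.
  have [<-|ne] := eqVneq (q sT v) x; first by apply: emdef_ext (Pdef v) => D u; split=> // /(_ erefl).
  by apply: emdef_ext (emdef_const True) => D u; split=> // _ e; rewrite e eqxx in ne.
split=> [[[s T] [/= FT [h hE hP]]]|[h /homsP[hw hF] hP]].
  exists [ffun v => h (q (s, T) v)] => [|v]; last by rewrite ffunE; apply: hP.
  apply/homsP; split; first by rewrite ffunE; have /embs_pat[] := hE.
  move=> f /FT fT; have := emb_quotient_hom hE fT.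
  by congr (_ : bool); apply: eq_fholds => v _; rewrite ffunE.
exists (kernel h, diagram h); split=> [f /hF|]; first by rewrite inE.
have [h' h'E h'h] := @emb_of_type S V val _ _ val_inj D h w erefl erefl.
exists h'; first by rewrite -hw.
by move=> x v <-; rewrite [h' _]h'h.
Qed.

(** Here the numbering [j] of the vertices is injective, so nothing is merged and [inord] recovers
    an index from a vertex of the pattern. *)
Lemma emdef_induced m (T : {set vfact S 'I_m.+1})
    (P : 'I_m.+1 -> forall D : database S, adom D -> Prop) :
  (forall i, emdef (P i)) ->
  emdef (fun D u => exists h : 'I_m.+1 -> adom D,
    [/\ h ord0 = u, injective h, diagram h = T & forall i, P i D (h i)]).
Proof.
move=> Pdef; pose j (i : 'I_m.+1) : nat := i.
have j_inj : injective j by exact: val_inj.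
have q_inj : injective (@vert S _ j T) by move=> i i' /(congr1 val) /= /j_inj.
have := @emdef_emb (pat j T) (vert j T ord0) (fun x => P (inord (val x))).
move=> /(_ (fun=> Pdef _)); apply: emdef_ext => D u.
have qT f : [exists f0 in T, relabel (vert j T) f0 == relabel (vert j T) f] = (f \in T).
  apply/exists_inP/idP => [[f0 f0T /eqP /(relabel_inj q_inj) <-] //|fT].
  by exists f.
split=> [[h /embs_pat[hw hi hT] hP]|[h [hw hi hT hP]]].
  exists (h \o vert j T); split=> // [i i' /hi /q_inj //||i].
    by apply/setP => f; rewrite inE -hT qT.
  by have := hP (vert j T i); rewrite /= inord_val.
have hE i : [ffun x : pdom (pat j T) => h (inord (val x))] (vert j T i) = h i.
  by rewrite ffunE /= inord_val.
exists [ffun x => h (inord (val x))] => [|x]; last first.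
  by have [i <-] := vert_surj x; rewrite hE /= inord_val.
apply/embs_pat; split=> [||f]; first by rewrite hE.
  move=> x y; have [i <-] := vert_surj x; have [i' <-] := vert_surj y.
  by rewrite !hE => /hi ->.
rewrite qT -hT inE; apply: eq_fholds => i _; exact/esym/hE.
Qed.

End EmbeddingFormulas.

(** * UQAFO *)

Section FirstOrder.
Variable S : schema.
Implicit Types (D : database S) (f g : fo S).

Lemma eq_sat D (a b : nat -> adom D) f : {in fv f, a =1 b} -> sat a f = sat b f.
Proof.
elim: f a b => [r z|x y|f IH|f IHf g IHg|f IHf g IHg|y f IH|y f IH] a b ab /=.
- exact: (@eq_fholds _ _ _ a b (existT _ r z)).
- by rewrite !ab ?inE ?eqxx ?orbT.
- by rewrite (IH a b).
- by rewrite (IHf a b) ?(IHg a b) // => z zf; apply: ab; rewrite /= mem_cat zf ?orbT.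
- by rewrite (IHf a b) ?(IHg a b) // => z zf; apply: ab; rewrite /= mem_cat zf ?orbT.
- apply: eq_existsb => u; apply: IH => z zf; rewrite /upd; case: eqVneq => // zy.
  by apply: ab; rewrite mem_filter zy.
- apply: eq_forallb => u; apply: IH => z zf; rewrite /upd; case: eqVneq => // zy.
  by apply: ab; rewrite mem_filter zy.
Qed.

Lemma sat_unary D (a : nat -> adom D) x f :
  fv_in x f -> sat a f = sat (fun=> a x) f.
Proof. by move=> fx; apply: eq_sat => z /fx; rewrite inE => /eqP ->. Qed.

Lemma comp_upd D D' (p : adom D -> adom D') (a : nat -> adom D) y u :
  p \o upd a y u = upd (p \o a) y (p u).
Proof. by apply: funext => z; rewrite /= /upd; case: ifP. Qed.

(** A partial isomorphism with domain [W] that respects the labels [L], given as a total map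
    constrained only on [W]. *)
Definition preserves (I : Type) (L : I -> emf S) D D' (p : adom D -> adom D')
    (W : seq (adom D)) : Prop :=
  [/\ {in W &, injective p},
      forall f : vfact S (adom D), {subset val (tagged f) <= W} ->
        fholds p f = fholds id f &
      forall x i, x \in W -> esat (p x) (L i) = esat x (L i)].

Lemma preserves_comp (I J : Type) (k : J -> I) (L : I -> emf S) D D'
    (p : adom D -> adom D') (W W' : seq (adom D)) :
  {subset W' <= W} -> preserves L p W -> preserves (L \o k) p W'.
Proof.
move=> sW [pi pf pL]; split=> [x y /sW xW /sW yW|f fW|x i /sW xW]; first exact: pi.
  by apply: pf => x /fW /sW.
exact: pL.
Qed.

(* A witness for the truth of an existential formula is a bounded set of
   elements such that the formula stays true under every partial map that
   preserves the induced labelled substructure on it. *)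
Definition witnessed (P : forall D, (nat -> adom D) -> bool) (xs : seq nat) : Prop :=
  exists (q : nat) (I : finType) (L : I -> emf S), forall D (a : nat -> adom D),
    P D a -> exists2 W : seq (adom D), (size W <= q)%N &
      forall D' (p : adom D -> adom D'),
        preserves L p (W ++ map a xs) -> P D' (p \o a).

Lemma witnessed_and P Q xs ys : witnessed P xs -> witnessed Q ys ->
  witnessed (fun D a => P D a && Q D a) (xs ++ ys).
Proof.
move=> [q [I [L HP]]] [q' [I' [L' HQ]]].
exists (q + q')%N, (I + I')%type, (fun i => match i with inl i => L i | inr i => L' i end).
move=> D a /andP[/HP[W Wq HW] /HQ[W' Wq' HW']].
exists (W ++ W') => [|D' p pP]; first by rewrite size_cat leq_add.
apply/andP; split.
  apply: HW; apply: (preserves_comp inl) pP => x.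
  by rewrite map_cat !mem_cat => /orP[] ->; rewrite ?orbT.
apply: HW'; apply: (preserves_comp inr) pP => x.
by rewrite map_cat !mem_cat => /orP[] ->; rewrite ?orbT.
Qed.

Lemma witnessed_or P Q xs ys : witnessed P xs -> witnessed Q ys ->
  witnessed (fun D a => P D a || Q D a) (xs ++ ys).
Proof.
move=> [q [I [L HP]]] [q' [I' [L' HQ]]].
exists (q + q')%N, (I + I')%type, (fun i => match i with inl i => L i | inr i => L' i end).
move=> D a /orP[/HP[W Wq HW]|/HQ[W Wq HW]].
  exists W => [|D' p pP]; first exact: leq_trans Wq (leq_addr _ _).
  apply/orP; left; apply: HW; apply: (preserves_comp inl) pP => x.
  by rewrite map_cat !mem_cat => /orP[] ->; rewrite ?orbT.
exists W => [|D' p pP]; first exact: leq_trans Wq (leq_addl _ _).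
apply/orP; right; apply: HW; apply: (preserves_comp inr) pP => x.
by rewrite map_cat !mem_cat => /orP[] ->; rewrite ?orbT.
Qed.

(** The value chosen for [y] joins the witness set, since [y] is no longer among the listed
    variables; hence the bound [q.+1]. *)
Lemma witnessed_ex P xs y : witnessed P xs ->
  witnessed (fun D a => [exists u, P D (upd a y u)]) [seq x <- xs | x != y].
Proof.
move=> [q [I [L HP]]]; exists q.+1, I, L => D a /existsP[u /HP[W Wq HW]].
exists (u :: W) => // D' p pP; apply/existsP; exists (p u).
rewrite -comp_upd; apply: HW; apply: (preserves_comp id) pP => x.
rewrite !mem_cat inE => /orP[->|/mapP[z zxs ->]]; first by rewrite orbT.
rewrite /upd; case: (eqVneq z y) => [_|zy]; first by rewrite eqxx.
by apply/orP; right; apply: map_f; rewrite mem_filter zy.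
Qed.

Lemma witnessed_qfree P xs :
  (forall D D' (a : nat -> adom D) (p : adom D -> adom D'),
     preserves (fun i : void => match i with end) p (map a xs) -> P D' (p \o a) = P D a) ->
  witnessed P xs.
Proof.
move=> H; exists 0%N, void, (fun i : void => match i with end) => D a Pa.
by exists [::] => // D' p pP; rewrite H.
Qed.

(** The formula is a finite disjunction over sizes, diagrams [T] and colourings [c] by the labels,
    restricted to those that force [P] at the first element. If [P] holds at [u], then [u] with its
    witness set has at most [q.+1] elements, and the map from it to any other realisation of its
    type preserves all that matters, so its own type is in the disjunction. *)
Lemma witnessed_unary P xs x :
  {subset xs <= [:: x]} ->
  (forall D (a b : nat -> adom D), {in xs, a =1 b} -> P D a = P D b) ->
  witnessed P xs -> emdef (fun D u => P D (fun=> u)).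
Proof.
move=> xsx Pext [q [I [L HL]]].
(* This quantifies over all databases and so depends on [(T, c)] alone; [emdef_const] brings it into
   the formula. *)
pose good m (T : {set vfact S 'I_m.+1}) (c : {ffun 'I_m.+1 -> {ffun I -> bool}}) :=
  forall D (h : 'I_m.+1 -> adom D), injective h -> diagram h = T ->
    (forall i k, esat (h i) (L k) = c i k) -> P D (fun=> h ord0).
have H := @emdef_exists S 'I_q.+1 (fun m D u =>
  exists T, exists c, good m T c /\ exists h : 'I_m.+1 -> adom D,
    [/\ h ord0 = u, injective h, diagram h = T &
        forall i k, esat (h i) (L k) = c i k]).
apply: emdef_ext (H _) => {H} [D u|m]; last first.
  apply: (emdef_exists (P := fun T D u => _)) => T.
  apply: (emdef_exists (P := fun c D u => _)) => c.
  apply: emdef_and; first exact: emdef_const.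
  apply: (@emdef_induced _ _ _ (fun i D u => forall k, esat u (L k) = c i k)) => i.
  apply: (emdef_forall (P := fun k D u => esat u (L k) = c i k)) => k.
  have H : emdef (fun D (u : adom D) => esat u (L k)) by exists (L k).
  case: (c i k); first exact: H.
  by apply: emdef_ext (emdef_not H) => D u; split=> [/negP/negbTE|->].
split=> [[m [T [c [gd [h [<- hi hT hc]]]]]]|Pu]; first exact: gd hT hc.
have [W Wq HW] := HL D _ Pu.
(* [u] comes first so that [h ord0] is [u]; removing duplicates makes [h] injective. *)
pose s := u :: [seq x <- undup W | x != u].
have s_uniq : uniq s by rewrite /= mem_filter eqxx filter_uniq ?undup_uniq.
have Ws : {subset W ++ map (fun=> u) xs <= s}.
  move=> z; rewrite mem_cat inE mem_filter mem_undup => /orP[->|/mapP[_ _ ->]].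
    by rewrite andbT; case: eqP.
  by rewrite eqxx.
have s_size : ((size s).-1 < q.+1)%N.
  rewrite ltnS /= size_filter; apply: leq_trans (count_size _ _) _.
  exact: leq_trans (size_undup _) Wq.
pose m := Ordinal s_size.
pose h (i : 'I_m.+1) := nth u s i.
have hi : injective h by move=> i i' /eqP; rewrite nth_uniq // => /eqP /val_inj.
pose idx z : 'I_m.+1 := inord (index z s).
have idxK : {in s, cancel idx h}.
  move=> z zs; rewrite /h /idx inordK ?nth_index //.
  by have := zs; rewrite -index_mem.
exists m, (diagram h), [ffun i => [ffun k => esat (h i) (L k)]]; split; last first.
  by exists h; split=> // i k; rewrite !ffunE.
move=> D' h' h'i h'T h'c.
have <- : h' (idx u) = h' ord0.
  by congr h'; apply: val_inj; rewrite /= inordK //= eqxx.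
apply: (HW D' (h' \o idx)); split=> [y z /Ws ys /Ws zs /h'i e|f fW|y k /Ws ys].
- by rewrite -(idxK y) // e idxK.
- have fE : f = relabel h (relabel idx f).
    case: f fW => r t fW; rewrite relabel_comp /relabel /=; congr existT.
    apply: val_inj; rewrite /= map_id_in // => z zt; apply: idxK; exact/Ws/fW.
  rewrite {2}fE fholds_relabel -(fholds_relabel idx h').
  have /setP/(_ (relabel idx f)) := h'T; rewrite !inE => ->.
  by apply: eq_fholds.
by rewrite h'c !ffunE idxK.
Qed.

Scheme uq_ex_mut := Induction for uq_ex Sort Prop
  with uq_all_mut := Induction for uq_all Sort Prop.
Combined Scheme uq_mut from uq_ex_mut, uq_all_mut.

Lemma witnessed_ext P Q xs : (forall D a, P D a = Q D a) ->
  witnessed P xs -> witnessed Q xs.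
Proof.
move=> PQ; suff -> : P = Q by [].
by apply: functional_extensionality_dep => D; apply: funext.
Qed.

(** The universal half is stated for negations, so both halves have existential form. Where the two
    classes alternate the formula is unary: it is turned into an embedding formula and becomes a
    single label. *)
Lemma uq_witnessed :
  (forall f, uq_ex f -> witnessed (fun D a => sat a f) (fv f)) /\
  (forall f, uq_all f -> witnessed (fun D a => ~~ sat a f) (fv f)).
Proof.
have atomP r (z : (ar r).-tuple nat) D D' (a : nat -> adom D) (p : adom D -> adom D') :
    preserves (fun i : void => match i with end) p (map a z) ->
    sat (p \o a) (Atom z) = sat a (Atom z).
  move=> [_ pf _]; have := pf (existT _ r (map_tuple a z)) (fun x => id).
  by rewrite -[existT _ _ _]/(relabel a (existT _ r z)) !fholds_relabel.
have eqlP x y D D' (a : nat -> adom D) (p : adom D -> adom D') :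
    preserves (fun i : void => match i with end) p (map a [:: x; y]) ->
    sat (p \o a) (Eql x y) = sat a (Eql x y).
  move=> [pi _ _] /=; apply/eqP/eqP => [|-> //].
  by apply: pi; rewrite !inE eqxx ?orbT.
(* Labels are preserved in both directions, so one label serves for [f] and, with [b] true, for its
   negation. The element [a x] is put in the witness set because [x] might not occur in [fv f]. *)
have unaryP x f : emdef (fun D u => sat (fun=> u) f) -> fv_in x f ->
    forall b : bool, witnessed (fun D a => sat a f (+) b) (fv f).
  move=> [e eP] fx b; exists 1%N, unit, (fun=> e) => D a sf.
  exists [:: a x] => // D' p [_ _ pL].
  have eP' D1 (u : adom D1) : sat (fun=> u) f = esat u e.
    by apply/idP/idP; rewrite -eP.
  by move: sf; rewrite (sat_unary a fx) (sat_unary (p \o a) fx) !eP' /= (pL (a x) tt) ?inE ?eqxx.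
apply: uq_mut => [r z|r z|f g _ IHf _ IHg|f g _ IHf _ IHg|x y|x y|y f _ IH|x f _ IH fx
  |r z|r z|f g _ IHf _ IHg|f g _ IHf _ IHg|x y|x y|y f _ IH|x f _ IH fx].
- exact/witnessed_qfree/atomP.
- by apply: witnessed_qfree => D D' a p /atomP /= ->.
- exact: witnessed_and.
- exact: witnessed_or.
- exact/witnessed_qfree/eqlP.
- by apply: witnessed_qfree => D D' a p /eqlP /= ->.
- exact: (@witnessed_ex (fun D a => sat a f)).
- apply: witnessed_ext (unaryP x f _ fx false) => [D a|]; first by rewrite addbF.
  apply: emdef_ext (emdef_not (witnessed_unary fx _ IH)) => [D u|D a b ab].
    by split=> [/negP/negPn|? /negP].
  by rewrite (eq_sat ab).
- by apply: witnessed_qfree => D D' a p /atomP /= ->.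
- by apply: witnessed_qfree => D D' a p /atomP /= ->.
- by apply: witnessed_ext (witnessed_or IHf IHg) => D a /=; rewrite negb_and.
- by apply: witnessed_ext (witnessed_and IHf IHg) => D a /=; rewrite negb_or.
- by apply: witnessed_qfree => D D' a p /eqlP /= ->.
- by apply: witnessed_qfree => D D' a p /eqlP /= ->.
- by apply: witnessed_ext (witnessed_ex y IH) => D a /=; rewrite negb_forall.
- apply: witnessed_ext (unaryP x f _ fx true) => [D a|]; first by rewrite addbT.
  apply: witnessed_unary fx _ IH => D a b; exact: eq_sat.
Qed.

Lemma uqafo_emdef x f : uqafo f -> fv_in x f -> emdef (fun D u => sat (fun=> u) f).
Proof.
elim=> {f} [f fE fx|f fA fx|f g _ IHf _ IHg fx|f g _ IHf _ IHg fx].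
- by apply: witnessed_unary fx _ (uq_witnessed.1 f fE) => D a b; exact: eq_sat.
- have := witnessed_unary fx _ (uq_witnessed.2 f fA) => /(_ _)/emdef_not.
  have H D (a b : nat -> adom D) : {in fv f, a =1 b} -> ~~ sat a f = ~~ sat b f.
    by move=> /eq_sat ->.
  by move=> /(_ H); apply: emdef_ext => D u; split=> [/negP/negPn|? /negP].
- have [fx' gx] : fv_in x f /\ fv_in x g.
    by split=> z zf; apply: fx; rewrite /= mem_cat zf ?orbT.
  apply: emdef_ext (emdef_and (IHf fx') (IHg gx)) => D u /=.
  by split=> [[-> ->]|/andP[]].
- have [fx' gx] : fv_in x f /\ fv_in x g.
    by split=> z zf; apply: fx; rewrite /= mem_cat zf ?orbT.
  apply: emdef_ext (emdef_or (IHf fx') (IHg gx)) => D u /=.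
  by split=> /orP.
Qed.

End FirstOrder.

(** * EML *)

Section EML.
Variable S : schema.

(** [ys] may contain repetitions: an outer quantifier over [y] is given [b y], the value that [y]
    finally takes. *)
Lemma sat_foldr_ex (D : database S) (a : nat -> adom D) (ys : seq nat) (f : fo S) :
  sat a (foldr (@Ex S) f ys) <->
  exists2 b : nat -> adom D, {in [predC ys], b =1 a} & sat b f.
Proof.
elim: ys a => [|y ys IH] a /=.
  split=> [sf|[b ba]]; first by exists a.
  by congr (is_true (sat _ f)); apply: funext => z; apply: ba.
split=> [/existsP[u /IH[b ba sf]]|[b ba sf]].
  exists b => // z; rewrite !inE negb_or => /andP[zy zys].
  by rewrite ba ?inE // /upd (negbTE zy).
apply/existsP; exists (b y); apply/IH; exists b => // z; rewrite inE => zys.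
rewrite /upd; case: eqVneq => [-> //|zy].
by apply: ba; rewrite !inE negb_or zy.
Qed.

Lemma fv_foldr_ex (ys : seq nat) (f : fo S) :
  fv (foldr (@Ex S) f ys) = [seq z <- fv f | z \notin ys].
Proof.
elim: ys => [|y ys IH] /=; first by rewrite filter_predT.
by rewrite IH -filter_predI; apply: eq_filter => z; rewrite /= inE negb_or.
Qed.

(** Truth is obtained as the negation of [x != x] under an empty quantifier block. *)
Lemma eml_true x : exists2 f : fo S, eml x f & forall D (a : nat -> adom D), sat a f.
Proof.
exists (Neg (foldr (@Ex S) (Neg (Eql x x)) [::])) => [|D a] /=; last by rewrite eqxx.
by apply: emNeg; apply: (@emEx S x [::]); apply: ecNeq; rewrite inE.
Qed.

Lemma eml_conj_all (I : Type) (zs : seq nat) (s : seq I) (t : I -> fo S) :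
  zs != [::] -> (forall i, eml_conj zs (t i)) ->
  exists2 f, eml_conj zs f &
    forall D (a : nat -> adom D), sat a f = all (fun i => sat a (t i)) s.
Proof.
case: zs => // z zs _ tzs; elim: s => [|i s [f fzs fP]].
  have [f fz fT] := eml_true z; exists f; last by move=> D a; rewrite fT.
  by apply: ecSub fz; rewrite inE eqxx.
by exists (And (t i) f) => [|D a /=]; [exact: ecAnd|rewrite fP].
Qed.

(** An embedding is written out with one variable per vertex: a literal for each possible fact, an
    inequality for each pair of distinct vertices, and the translated label of each vertex. *)
Lemma emf_eml (e : emf S) x :
  exists2 f, eml x f & forall D (a : nat -> adom D), sat a f = esat (a x) e.
Proof.
elim: e x => [|e IH|e1 IH1 e2 IH2|F w l IH] x.
- by have [f fx fT] := eml_true x; exists f => // D a; rewrite fT.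
- by have [f fx fP] := IH x; exists (Neg f) => [|D a /=]; [exact: emNeg|rewrite fP].
- have [f fx fP] := IH1 x; have [g gx gP] := IH2 x.
  by exists (Or f g) => [|D a /=]; [exact: emOr|rewrite fP gP].
pose V : finType := pdom F.
(* The root keeps the free variable [x]; the others get variables above [x], shifted by one to avoid
   [x] itself. *)
pose var (v : V) := if v == w then x else (x + (enum_rank v).+1)%N.
have var_inj : injective var.
  move=> v v'; rewrite /var; case: eqVneq => [->|_]; case: eqVneq => [->|_] //.
  - by rewrite -{1}[x]addn0 => /addnI.
  - by rewrite -{2}[x]addn0 => /addnI.
  - by move/addnI => [e]; apply/enum_rank_inj/val_inj.
pose ys := [seq var v | v <- enum V & v != w].
have ysx : x \notin ys.
  apply/mapP => -[v]; rewrite mem_filter /var => /andP[/negbTE -> _].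
  by rewrite -{1}[x]addn0 => /addnI.
have var_ys v : var v \in x :: ys.
  rewrite inE; have [->|vw] := eqVneq v w; first by rewrite /var !eqxx.
  by apply/orP; right; apply: map_f; rewrite mem_filter vw mem_enum.
have /choice[tl tlP] : forall v, exists g, eml (var v) g /\
    forall D (a : nat -> adom D), sat a g = esat (a (var v)) (l v).
  by move=> v; have [g] := IH v (var v); exists g.
pose lits (f : vfact S V) : fo S :=
  let g := Atom (tagged (relabel var f)) in if pholds f then g else Neg g.
have litsP f : eml_conj (x :: ys) (lits f).
  have zs : {subset tagged (relabel var f) <= x :: ys} by move=> _ /mapP[v _ ->].
  by rewrite /lits; case: ifP => _; constructor.
(* A diagonal pair must also yield a conjunct; it repeats the label of the root, which is asserted
   anyway. *)
pose neqs (p : V * V) : fo S :=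
  if p.1 == p.2 then tl w else Neg (Eql (var p.1) (var p.2)).
have neqsP p : eml_conj (x :: ys) (neqs p).
  rewrite /neqs; case: ifP => _; last by apply: ecNeq.
  by apply: (ecSub _ (tlP w).1).
have tlsP v : eml_conj (x :: ys) (tl v) by apply: (ecSub _ (tlP v).1).
have [f1 f1zs f1P] := @eml_conj_all _ (x :: ys) (enum {: vfact S V}) _ isT litsP.
have [f2 f2zs f2P] := @eml_conj_all _ (x :: ys) (enum {: V * V}) _ isT neqsP.
have [f3 f3zs f3P] := @eml_conj_all _ (x :: ys) (enum V) _ isT tlsP.
exists (foldr (@Ex S) (And (And f1 f2) f3) ys) => [|D a].
  by apply: emEx; do 2?apply: ecAnd.
apply/idP/idP => [/sat_foldr_ex[b ba /= /andP[/andP[]]]|/= /exists_inP[h]].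
  rewrite f1P f2P f3P => /allP s1 /allP s2 /allP s3.
  have sl v : esat (b (var v)) (l v) by rewrite -(tlP v).2 s3 ?mem_enum.
  apply/exists_inP; exists [ffun v => b (var v)]; last by apply/forallP => v; rewrite ffunE.
  apply/embsP; split=> [|v v'|f].
  - by rewrite ffunE /var eqxx ba.
  - rewrite !ffunE => e; apply/eqP; apply: contraT => /negbTE vv'.
    by have := s2 (v, v') (mem_enum _ _); rewrite /neqs /= vv' /= e eqxx.
  have -> : fholds [ffun v => b (var v)] f = sat b (Atom (tagged (relabel var f))).
    transitivity (fholds b (relabel var f)) => //.
    by rewrite fholds_relabel; apply: eq_fholds => v _; rewrite ffunE.
  by have := s1 f (mem_enum _ _); rewrite /lits; case: (pholds f) => /= [->|/negbTE ->].
move=> /embsP[hw hi hf] /forallP hl; apply/sat_foldr_ex.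
pose b z := if [pick v | var v == z] is Some v then h v else a z.
have bE v : b (var v) = h v.
  rewrite /b; case: pickP => [v' /eqP/var_inj -> //|/(_ v)].
  by rewrite eqxx.
exists b => [z|/=].
  rewrite inE => zys; rewrite /b; case: pickP => // v /eqP vz.
  move: zys; rewrite -vz; have := var_ys v; rewrite inE => /predU1P[vx _|-> //].
  have -> : v = w by apply: var_inj; rewrite vx /var eqxx.
  by rewrite /var eqxx hw.
rewrite f1P f2P f3P; apply/andP; split; [apply/andP; split|]; apply/allP.
- move=> f _; rewrite /lits hf.
  have -> : fholds h f = sat b (Atom (tagged (relabel var f))).
    transitivity (fholds b (relabel var f)) => //.
    by rewrite fholds_relabel; apply: eq_fholds => v _; rewrite /= bE.
  by case: ifP => //= ->.
- move=> [v v'] _; rewrite /neqs /=; case: eqVneq => [_|vv'] /=.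
    by rewrite (tlP w).2 bE.
  by rewrite !bE; apply: contra vv' => /eqP/hi ->.
- by move=> v _; rewrite (tlP v).2 bE.
Qed.

(** De Morgan duality exchanges the two classes. Keeping [fv] unchanged is what lets the dual of a
    unary subformula pass through the alternation rule. *)
Lemma uq_dual :
  (forall f : fo S, uq_ex f -> exists g, [/\ uq_all g, fv g = fv f &
     forall D (a : nat -> adom D), sat a g = ~~ sat a f]) /\
  (forall f : fo S, uq_all f -> exists g, [/\ uq_ex g, fv g = fv f &
     forall D (a : nat -> adom D), sat a g = ~~ sat a f]).
Proof.
apply: uq_mut => [r z|r z|f g _ [f' [f'P fvf f'E]] _ [g' [g'P fvg g'E]]
  |f g _ [f' [f'P fvf f'E]] _ [g' [g'P fvg g'E]]|x y|x y|y f _ [f' [f'P fvf f'E]]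
  |x f _ [f' [f'P fvf f'E]] fx
  |r z|r z|f g _ [f' [f'P fvf f'E]] _ [g' [g'P fvg g'E]]
  |f g _ [f' [f'P fvf f'E]] _ [g' [g'P fvg g'E]]|x y|x y|y f _ [f' [f'P fvf f'E]]
  |x f _ [f' [f'P fvf f'E]] fx].
- by exists (Neg (Atom z)); split=> //; constructor.
- by exists (Atom z); split=> [|//|D a /=]; [constructor|rewrite negbK].
- by exists (Or f' g'); split=> [||D a] /=; [constructor|rewrite fvf fvg|rewrite f'E g'E negb_and].
- by exists (And f' g'); split=> [||D a] /=; [constructor|rewrite fvf fvg|rewrite f'E g'E negb_or].
- by exists (Neg (Eql x y)); split=> //; constructor.
- by exists (Eql x y); split=> [|//|D a /=]; [constructor|rewrite negbK].
- exists (All y f'); split=> [||D a] /=; [by constructor|by rewrite fvf|].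
  by rewrite negb_exists; apply: eq_forallb => u; rewrite f'E.
- exists f'; split=> //; apply: uaEx1 (x) _ f'P _.
  by rewrite /fv_in fvf.
- by exists (Neg (Atom z)); split=> //; constructor.
- by exists (Atom z); split=> [|//|D a /=]; [constructor|rewrite negbK].
- by exists (Or f' g'); split=> [||D a] /=; [constructor|rewrite fvf fvg|rewrite f'E g'E negb_and].
- by exists (And f' g'); split=> [||D a] /=; [constructor|rewrite fvf fvg|rewrite f'E g'E negb_or].
- by exists (Neg (Eql x y)); split=> //; constructor.
- by exists (Eql x y); split=> [|//|D a /=]; [constructor|rewrite negbK].
- exists (Ex y f'); split=> [||D a] /=; [by constructor|by rewrite fvf|].
  by rewrite negb_forall; apply: eq_existsb => u; rewrite f'E.
- exists f'; split=> //; apply: ueAll1 (x) _ f'P _.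
  by rewrite /fv_in fvf.
Qed.

Scheme eml_mut_ind := Induction for eml Sort Prop
  with eml_conj_mut_ind := Induction for eml_conj Sort Prop.
Combined Scheme eml_mut from eml_mut_ind, eml_conj_mut_ind.

(** All formulas land in [uq_ex]. The dual of a unary existential formula is universal and still
    unary, so it counts as existential again; this handles negation. *)
Lemma eml_uq :
  (forall x (f : fo S), eml x f -> exists g, [/\ uq_ex g, fv_in x g &
     forall D (a : nat -> adom D), sat a g = sat a f]) /\
  (forall zs (f : fo S), eml_conj zs f -> exists g, [/\ uq_ex g, {subset fv g <= zs} &
     forall D (a : nat -> adom D), sat a g = sat a f]).
Proof.
apply: eml_mut.
- move=> x f _ [g [gE gx gP]]; have [g' [g'A g'fv g'P]] := uq_dual.1 g gE.
  have g'x : fv_in x g' by rewrite /fv_in g'fv.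
  exists g'; split=> [|//|D a /=]; last by rewrite g'P gP.
  exact: ueAll1 g'A g'x.
- move=> x f g _ [f' [f'E f'x f'P]] _ [g' [g'E g'x g'P]].
  exists (Or f' g'); split=> [|z|D a /=]; [by constructor| |by rewrite f'P g'P].
  by rewrite mem_cat => /orP[/f'x|/g'x].
- move=> x ys f _ [g [gE gx gP]].
  exists (foldr (@Ex S) g ys); split.
  + by elim: (ys) => //= y ys' IH; constructor.
  + move=> z; rewrite fv_foldr_ex mem_filter => /andP[zys /gx].
    by rewrite !inE (negbTE zys) orbF.
  + move=> D a; apply/idP/idP => /sat_foldr_ex[b ba sb]; apply/sat_foldr_ex;
      by exists b; rewrite // ?gP // -gP.
- by move=> zs r z zzs; exists (Atom z); split=> //; constructor.
- by move=> zs r z zzs; exists (Neg (Atom z)); split=> //; constructor.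
- move=> zs z1 z2 z1s z2s; exists (Neg (Eql z1 z2)); split=> [|z|//].
    by constructor.
  by rewrite !inE => /orP[/eqP ->|/eqP ->].
- move=> zs z f zzs _ [g [gE gz gP]]; exists g; split=> // z' /gz.
  by rewrite inE => /eqP ->.
- move=> zs f g _ [f' [f'E f'x f'P]] _ [g' [g'E g'x g'P]].
  exists (And f' g'); split=> [|z|D a /=]; [by constructor| |by rewrite f'P g'P].
  by rewrite mem_cat => /orP[/f'x|/g'x].
Qed.

End EML.

(** * Evaluating formulas by networks *)

Section Aggregation.
Variable R : realType.
Implicit Type s : seq R.

Lemma agg_sumE s : agg_sum (seq_mset s) = \sum_(x <- s) x.
Proof. by rewrite /agg_sum (perm_big _ (perm_eq_seq_mset s)). Qed.

Lemma agg_maxP s x : x \in s ->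
  agg_max (seq_mset s) \in s /\ forall y, y \in s -> y <= agg_max (seq_mset s).
Proof.
move=> xs; have sE := perm_mem (perm_eq_seq_mset s).
suff [H1 H2] : agg_max (seq_mset s) \in (seq_mset s : seq R) /\
    forall y, y \in (seq_mset s : seq R) -> y <= agg_max (seq_mset s).
  by split=> [|y ys]; [rewrite -sE|apply: H2; rewrite sE].
rewrite /agg_max; move: xs; rewrite -sE.
case: (EnumMset.f _) => // y t _ {sE x}.
elim: t => [|z t [IH1 IH2]].
  by rewrite big_nil; split=> [|x]; rewrite inE // => /eqP ->.
rewrite big_cons; split=> [|x].
  rewrite maxEle; case: ifP => _; last by rewrite !inE eqxx orbT.
  by move: IH1; rewrite !inE => /orP[]->; rewrite ?orbT.
rewrite !inE le_max => /or3P[/eqP ->|/eqP ->|xt]; rewrite ?lexx //.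
  by rewrite (IH2 y) ?orbT // inE eqxx.
by rewrite (IH2 x) ?orbT // inE xt orbT.
Qed.

Lemma agg_max_nil : agg_max (seq_mset [::]) = 0 :> R.
Proof.
rewrite /agg_max; have := perm_size (perm_eq_seq_mset ([::] : seq R)).
by case: (EnumMset.f _).
Qed.

(** A maximum is attained and is an upper bound, so it ignores multiplicities. In the empty case
    both lists are empty. *)
Lemma eq_agg_max s s' : s =i s' -> agg_max (seq_mset s) = agg_max (seq_mset s').
Proof.
case: s => [|x s] ss'.
  by case: s' ss' => // x s' /(_ x); rewrite !inE eqxx.
have xs : x \in x :: s by rewrite inE eqxx.
have [m1 m2] := agg_maxP xs; rewrite ss' in xs; have [n1 n2] := agg_maxP xs.
by apply/le_anti; rewrite n2 -?ss' // m2 // ss'.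
Qed.

Definition detects (agg : aggregation R) : Prop :=
  forall s, {subset s <= [:: 0; 1]} -> (agg (seq_mset s) != 0) = (1 \in s).

Lemma detects_sum : detects (@agg_sum R).
Proof.
move=> s s01; rewrite agg_sumE big_seq psumr_neq0 => [|x /s01]; last first.
  by rewrite !inE => /orP[]/eqP ->; rewrite ?ler01.
apply/hasP/idP => [[x _ /andP[xs]]|s1]; last by exists 1; rewrite //= s1 ltr01.
by move: (xs) => /s01; rewrite !inE => /orP[]/eqP xE; rewrite xE ?ltxx // -xE.
Qed.

Lemma detects_max : detects (@agg_max R).
Proof.
move=> s s01; apply/idP/idP => [|s1]; last first.
  by have [_ /(_ _ s1) m1] := agg_maxP s1; rewrite gt_eqF // (lt_le_trans ltr01).
case: s s01 => [|x s] s01; first by rewrite agg_max_nil eqxx.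
have [m1 _] := @agg_maxP (x :: s) x (mem_head _ _).
by have := s01 _ m1; rewrite !inE => /orP[]/eqP mE; rewrite mE ?eqxx // -mE.
Qed.

End Aggregation.

Section Layers.
Variables (R : realType) (S : schema) (maps : map_family).

Section FinLayer.
Variables (d d' : nat) (I : finType) (dim : I -> nat).
Hypothesis dim_gt0 : forall i, (0 < dim i)%N.
Variables (q : forall i, query R S d (dim i)).
Variable (c : (forall i, 'rV[R]_(dim i)) -> 'rV[R]_d').

(** Queries indexed by any finite type instead of ordinals; [eq_rect] transports each result to the
    dimension of its own index. *)
Definition fin_layer : layer R S d d' :=
  @Layer R S d d' #|I| (fun k => dim (enum_val k)) (fun k => dim_gt0 _)
    (fun k => q (enum_val k))
    (fun g => c (fun i => eq_rect _ (fun i => 'rV[R]_(dim i))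
                            (g (enum_rank i)) _ (enum_rankK i))).

Lemma fin_layerE (D : database S) (lam : adom D -> 'rV[R]_d) u :
  layer_result maps fin_layer lam u = c (fun i => query_result maps (q i) lam u).
Proof.
rewrite /layer_result /=; congr c; apply: functional_extensionality_dep => i.
have H j (e : j = i) : eq_rect j (fun i => 'rV[R]_(dim i))
    (query_result maps (q j) lam u) i e = query_result maps (q i) lam u.
  by case: _ / e.
exact: H.
Qed.

Lemma fin_layer_agg agg : (forall i, qagg (q i) = agg) ->
  forall k, qagg (lquery fin_layer k) = agg.
Proof. by move=> H k; exact: H. Qed.

End FinLayer.

Lemma prod_indicator (V : finType) (b : pred V) :
  \prod_v (b v)%:R = [forall v, b v]%:R :> R.
Proof.
case: (boolP [forall v, b v]) => [/forallP H|/forallPn[v /negbTE nb]].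
  by rewrite big1 // => v _; rewrite H.
by rewrite (bigD1 v) //= nb mul0r.
Qed.

End Layers.

Section Computable.
Variables (R : realType) (S : schema) (agg : aggregation R).
Hypothesis agg_detects : detects agg.

Definition encode (X : finType) (x : X) : 'rV[R]_1 := const_mx (enum_rank x)%:R.
Definition decode (X : finType) (y : 'rV[R]_1) : option X :=
  [pick x | encode x == y].

Lemma encodeK (X : finType) : pcancel (@encode X) (@decode X).
Proof.
move=> x; rewrite /decode; case: pickP => [x' /eqP e|/(_ x)]; last by rewrite eqxx.
congr Some; apply/enum_rank_inj/val_inj/eqP.
by rewrite /= -(eqr_nat R); move/matrixP: e => /(_ 0 0); rewrite !mxE => ->.
Qed.

(** A network is read from its first layer inwards, so a computation is a function that prepends
    layers to an arbitrary continuation [N]. *)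
Definition computable (X : finType) (phi : forall D : database S, adom D -> X) : Prop :=
  exists pre : network R S 1 -> network R S 0, forall N,
    (uses_only agg N -> uses_only agg (pre N)) /\
    forall D, run embs (pre N) (fun=> 0) =1 run embs N (fun u => encode (phi D u)).

Lemma computable_start : computable (fun D u => tt).
Proof.
pose L := @fin_layer R S 0 1 void (fun=> 1%N) (fun=> isT)
  (fun i : void => match i with end) (fun=> encode tt).
exists (NLayer L) => N; split=> [uN|D u]; first by split=> //; apply: fin_layer_agg => -[].
by rewrite /=; congr (run _ _ _ _); apply: funext => v; rewrite fin_layerE.
Qed.

Definition test_query (X : finType) (F : pattern S) (w : pdom F)
    (mu : pdom F -> pred X) : query R S 1 1 :=
  (* The product of 0-1 values is the conjunction of the tests. The default 0 is not met on labels
     made by [encode]. *)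
  Query w (fun v y => const_mx (if decode X y is Some x then (mu v x)%:R else 0)) agg.

Lemma test_queryP (X : finType) (F : pattern S) (w : pdom F)
    (mu : pdom F -> pred X) (D : database S) (phi : adom D -> X) u :
  (query_result embs (test_query w mu) (fun v => encode (phi v)) u 0 0 != 0) =
  [exists h in embs w u, [forall v, mu v (phi (h v))]].
Proof.
have valE (h : {ffun pdom F -> adom D}) :
    \prod_v qmu (q := test_query w mu) v (encode (phi (h v))) 0 0 =
    [forall v, mu v (phi (h v))]%:R.
  rewrite -prod_indicator; apply: eq_bigr => v _.
  by rewrite /= mxE encodeK.
rewrite mxE agg_detects => [|x /imageP[h _ ->]]; last first.
  by rewrite valE !inE; case: [forall v, _]; rewrite eqxx ?orbT.
apply/imageP/exists_inP => -[h hE hP]; exists h => //; last by rewrite valE hP.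
by move: hP; rewrite valE; case: [forall v, _] => // /eqP; rewrite oner_eq0.
Qed.

(* A single-vertex pattern with exactly the loops of u embeds at u in exactly
   one way, so the old label is passed on by testing all such patterns. *)
Lemma computable_step (X Y : finType) (phi : forall D : database S, adom D -> X)
    (F : pattern S) (w : pdom F) (mu : pdom F -> pred X) (G : X -> bool -> Y) :
  computable phi -> computable (fun D u =>
    G (phi D u) [exists h in embs w u, [forall v, mu v (phi D (h v))]]).
Proof.
move=> [pre preP].
pose I := option ({set vfact S 'I_1} * X)%type.
pose q (i : I) : query R S 1 1 := if i is Some (T, x)
  then test_query (vert (val : 'I_1 -> nat) T ord0) (fun _ => pred1 x)
  else test_query w mu.
pose c (g : I -> 'rV[R]_1) : 'rV[R]_1 :=
  if [pick Tx | g (Some Tx) 0 0 != 0] is Some Tx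
  then encode (G Tx.2 (g None 0 0 != 0)) else 0.
pose L := fin_layer (fun=> isT : (0 < 1)%N) q c.
exists (fun N => pre (NLayer L N)) => N; have [preN1 preN2] := preP (NLayer L N).
split=> [uN|D u].
  by apply: preN1; split=> //; apply: fin_layer_agg => -[[T x]|].
rewrite preN2 /=; congr (run _ _ _ _); apply: funext => v; rewrite fin_layerE /c.
have sel Tx : (query_result embs (q (Some Tx)) (fun v => encode (phi D v)) v 0 0 != 0)
    -> Tx.2 = phi D v.
  case: Tx => T x; rewrite test_queryP => /exists_inP[h /embs_pat[hv _ _] /forallP H].
  by have /eqP <- := H (vert val T ord0); rewrite hv.
case: pickP => [Tx /sel ->|/(_ (diagram (fun _ : 'I_1 => v), phi D v))].
  by rewrite test_queryP.
rewrite test_queryP => /negbT/negP[]; apply/exists_inP.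
have v_inj : injective (fun _ : 'I_1 => v) by move=> i i' _; rewrite (ord1 i) (ord1 i').
have q_inj (T : {set vfact S _}) : injective (vert (val : 'I_1 -> nat) T) by move=> i i' _; rewrite (ord1 i) (ord1 i').
exists [ffun=> v]; last by apply/forallP => x; rewrite /= ffunE.
apply/embs_pat; split=> [||f]; first by rewrite ffunE.
  move=> x y; have [i <-] := vert_surj x; have [i' <-] := vert_surj y.
  by rewrite (ord1 i) (ord1 i').
have -> : fholds ([ffun=> v] \o vert val (diagram (fun _ : 'I_1 => v))) f = fholds (fun=> v) f.
  by apply: eq_fholds => i _; rewrite /= ffunE.
apply/exists_inP/idP => [[f0]|vf]; last by exists f; rewrite ?inE.
by rewrite inE => vf /eqP /(relabel_inj (q_inj _)) <-.
Qed.

(** A step with a dummy test whose answer is discarded. *)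
Lemma computable_comp (X Y : finType) (phi : forall D : database S, adom D -> X)
    (G : X -> Y) : computable phi -> computable (fun D u => G (phi D u)).
Proof.
move=> cphi; pose T : {set vfact S 'I_1} := set0.
exact: (computable_step (vert val T ord0) (fun _ _ => true) (fun x _ => G x) cphi).
Qed.

(** Generalising over [phi] carries earlier results along. For an embedding, the labels of the
    pattern are evaluated one vertex at a time into a finite function, and one further test reads
    them. *)
Lemma computable_emf (e : emf S) (X : finType)
    (phi : forall D : database S, adom D -> X) :
  computable phi -> computable (fun D u => (phi D u, esat u e)).
Proof.
elim: e X phi => [|e IH|e1 IH1 e2 IH2|F w l IH] X phi cphi.
- exact: (computable_comp (fun x => (x, true)) cphi).
- exact: (computable_comp (fun xb => (xb.1, ~~ xb.2)) (IH _ _ cphi)).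
- exact: (computable_comp (fun xb => (xb.1.1, xb.1.2 || xb.2)) (IH2 _ _ (IH1 _ _ cphi))).
have H (s : seq (pdom F)) : computable (fun D u =>
    (phi D u, [ffun v => (v \in s) && esat u (l v)])).
  elim: s => [|v s IHs].
    have -> : (fun (D : database S) (u : adom D) => (phi D u, [ffun v => (v \in [::]) && esat u (l v)]))
        = (fun D u => (phi D u, [ffun=> false])).
      apply: functional_extensionality_dep => D; apply: funext => u.
      by congr pair; apply/ffunP => v; rewrite !ffunE.
    exact: (computable_comp (fun x => (x, [ffun=> false])) cphi).
  have := computable_comp (fun yb : X * {ffun pdom F -> bool} * bool =>
    (yb.1.1, [ffun x => if x == v then yb.2 else yb.1.2 x])) (IH v _ _ IHs).
  congr computable; apply: functional_extensionality_dep => D; apply: funext => u.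
  by congr pair; apply/ffunP => x; rewrite !ffunE inE; case: eqVneq => [->|].
have := computable_step w (fun v (xf : X * {ffun pdom F -> bool}) => xf.2 v) (fun xf b => (xf.1, b)) (H (enum {: pdom F})).
congr computable; apply: functional_extensionality_dep => D; apply: funext => u.
congr pair; apply: eq_existsb => h; congr (_ && _); apply: eq_forallb => v.
by rewrite ffunE mem_enum.
Qed.

Lemma emf_network (e : emf S) : exists2 N : network R S 0, uses_only agg N &
  forall Dv : pointed_db S, naccepts embs N Dv = esat (pt Dv) e.
Proof.
have [pre preP] := computable_emf e computable_start.
pose N := NCls S (fun y : 'rV[R]_1 => decode (unit * bool)%type y == Some (tt, true)).
have [preN1 preN2] := preP N; exists (pre N); first exact: preN1.
by move=> Dv; rewrite /naccepts preN2 /= encodeK; case: (esat _ _).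
Qed.

End Computable.

(** * Max-networks *)

Section MaxNetworks.
Variables (R : realType) (S : schema) (maps : map_family).
Hypothesis maps_emdef : forall (F : pattern S) (w : pdom F)
    (P : pdom F -> forall D : database S, adom D -> Prop),
  (forall v, emdef (P v)) ->
  emdef (fun D u => exists2 h : {ffun pdom F -> adom D},
    h \in maps w u & forall v, P v D (h v)).

(** In particular [phi] takes finitely many values over all databases together. *)
Definition emf_determined (X : Type) (phi : forall D : database S, adom D -> X) : Prop :=
  exists (I : finType) (e : I -> emf S) (g : {ffun I -> bool} -> X),
    forall D (u : adom D), phi D u = g [ffun i => esat u (e i)].

Lemma emf_determined_bool (P : forall D : database S, adom D -> bool) :
  emf_determined P -> emdef (fun D u => P D u).
Proof.
move=> [I [e [g PE]]].
have := @emdef_exists S {ffun I -> bool} (fun b D u =>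
  g b /\ forall i, esat u (e i) = b i).
move=> /(_ _)/(emdef_ext _); apply=> [D u|b].
  rewrite PE; split=> [[b [gb eb]]|gb].
    by suff -> : [ffun i => esat u (e i)] = b by []; apply/ffunP => i; rewrite ffunE eb.
  by exists [ffun i => esat u (e i)]; split=> // i; rewrite ffunE.
apply: emdef_and; first exact: emdef_const.
apply: (emdef_forall (P := fun i D u => esat u (e i) = b i)) => i.
have H : emdef (fun D (u : adom D) => esat u (e i)) by exists (e i).
case: (b i); first exact: H.
by apply: emdef_ext (emdef_not H) => D u; split=> [/negP/negbTE|->].
Qed.

(** There is one new formula for each query and each profile, that is, each assignment of truth
    vectors to its vertices; it says that some map has this profile. The value of a map depends only
    on its profile, so the maximum over maps is the maximum over realised profiles. *)
Lemma emf_determined_layer (d d' : nat) (L : layer R S d d')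
    (phi : forall D : database S, adom D -> 'rV[R]_d) :
  (forall i, qagg (lquery L i) = @agg_max R) ->
  emf_determined phi -> emf_determined (fun D => layer_result maps L (phi D)).
Proof.
move=> Lmax [I [e [g phiE]]].
pose dom i : finType := pdom (qpat (lquery L i)).
pose K : finType := {i : 'I_(nq L) & {ffun dom i -> {ffun I -> bool}}}.
have /choice[e' e'P] (k : K) : exists e', forall D (u : adom D), esat u e' <->
    exists2 h : {ffun dom (tag k) -> adom D}, h \in maps (qroot (lquery L (tag k))) u &
      forall v, [ffun i => esat (h v) (e i)] = tagged k v.
  apply: (@maps_emdef _ _ (fun v D u => [ffun i => esat u (e i)] = tagged k v)) => v.
  have := @emf_determined_bool (fun D u => [ffun i => esat u (e i)] == tagged k v).
  move=> /(_ _)/(emdef_ext _); apply=> [D u|]; first by split=> /eqP.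
  by exists I, e, (fun b => b == tagged k v).
pose val_ i (l : dom i -> 'rV[R]_d) j := \prod_v qmu (q := lquery L i) v (l v) 0 j.
exists K, e', (fun b => com L (fun i => \row_j agg_max (seq_mset
  [seq val_ i (g \o l) j | l : {ffun dom i -> {ffun I -> bool}} in
     [pred l : {ffun dom i -> {ffun I -> bool}} | b (Tagged _ l)]]))).
move=> D u; rewrite /layer_result; congr com.
apply: functional_extensionality_dep => i; apply/rowP => j; rewrite !mxE Lmax.
apply: eq_agg_max => x; apply/imageP/imageP => -[h hP ->].
  exists [ffun v => [ffun k => esat (h v) (e k)]].
    rewrite inE ffunE; apply/e'P; exists h => //= v.
    by rewrite ffunE.
  by rewrite /val_; apply: eq_bigr => v _; rewrite /= phiE ffunE.
move: hP; rewrite inE ffunE => /e'P[h' h'm h'P]; exists h' => //.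
by rewrite /val_; apply: eq_bigr => v _; rewrite phiE h'P.
Qed.

Lemma max_network_emf (d : nat) (N : network R S d)
    (phi : forall D : database S, adom D -> 'rV[R]_d) :
  uses_only (@agg_max R) N -> emf_determined phi ->
  emdef (fun D u => run maps N (phi D) u).
Proof.
elim: N phi => {d} [d cls|d d' L N IH] phi /=.
  move=> _ [I [e [g phiE]]]; apply: emf_determined_bool.
  by exists I, e, (cls \o g) => D u; rewrite /= phiE.
by move=> [Lmax Nmax] dphi; apply: IH => //; exact: emf_determined_layer.
Qed.

Lemma max_network_emdef (N : network R S 0) : uses_only (@agg_max R) N ->
  emdef (fun D u => run maps N (fun=> 0) u).
Proof.
move=> Nmax; apply: max_network_emf (fun D (u : adom D) => 0) Nmax _.
by exists void, (fun i : void => match i with end), (fun=> 0).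
Qed.

End MaxNetworks.

(** * Sum-networks *)

Section SumNetworks.
Variables (R : realType) (S : schema).

(** Maps constant on the fibres of [q] correspond bijectively to maps on [X], and the factors of the
    product are grouped by fibre. *)
Lemma sum_quotient (V X A : finType) (q : V -> X)
    (P : pred {ffun V -> A}) (P' : pred {ffun X -> A}) (mu : V -> A -> R) :
  (forall x, exists v, q v = x) ->
  (forall (h : {ffun V -> A}) v v', P h -> q v = q v' -> h v = h v') ->
  (forall h' : {ffun X -> A}, P [ffun v => h' (q v)] = P' h') ->
  \sum_(h : {ffun V -> A} | P h) \prod_v mu v (h v) =
  \sum_(h' : {ffun X -> A} | P' h') \prod_x \prod_(v | q v == x) mu v (h' x).
Proof.
move=> /choice[s0 s0K] Pq PP'.
rewrite (reindex_onto (fun h' : {ffun X -> A} => [ffun v => h' (q v)])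
  (fun h : {ffun V -> A} => [ffun x => h (s0 x)])) /=; last first.
  by move=> h hP; apply/ffunP => v; rewrite !ffunE; apply: Pq => //; rewrite s0K.
apply: eq_big => [h'|h' _].
  rewrite PP'; have -> : [ffun x => [ffun v => h' (q v)] (s0 x)] = h'.
    by apply/ffunP => x; rewrite !ffunE s0K.
  by rewrite eqxx andbT.
rewrite (partition_big q predT) //=; apply: eq_bigr => x _.
by apply: eq_bigr => v /eqP <-; rewrite ffunE.
Qed.

Lemma sum_query_resultE (maps : map_family) (d d' : nat) (q : query R S d d')
    (D : database S) (lam : adom D -> 'rV[R]_d) u j :
  qagg q = @agg_sum R ->
  query_result maps q lam u 0 j =
  \sum_(h in maps S (qpat q) (qroot q) D u) \prod_v qmu v (lam (h v)) 0 j.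
Proof. by move=> qs; rewrite mxE qs agg_sumE big_image. Qed.

Section LinearCombinations.
Variables (maps : map_family) (d d' : nat).

Definition sum_query : Type :=
  {F : pattern S & (pdom F * (pdom F -> 'rV[R]_d -> 'rV[R]_d'))%type}.
Definition to_query (q : sum_query) : query R S d d' :=
  Query (projT2 q).1 (projT2 q).2 (@agg_sum R).

Definition label_map := forall D : database S, (adom D -> 'rV[R]_d) -> adom D -> 'rV[R]_d'.

(** The coefficients and queries are the same for all databases and labelings, so a combination
    function can apply them. *)
Definition lin_comb (f : label_map) : Prop :=
  exists s : seq (R * sum_query), forall D lam u,
    f D lam u = \sum_(p <- s) p.1 *: query_result maps (to_query p.2) lam u.

Lemma lin_comb_ext (f g : label_map) :
  (forall D lam u, f D lam u = g D lam u) -> lin_comb f -> lin_comb g.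
Proof. by move=> fg [s sP]; exists s => D lam u; rewrite -fg. Qed.

Lemma lin_comb_query (q : sum_query) : lin_comb (query_result maps (to_query q)).
Proof. by exists [:: (1, q)] => D lam u; rewrite big_seq1 scale1r. Qed.

Lemma lin_combD (f g : label_map) (a : R) : lin_comb f -> lin_comb g ->
  lin_comb (fun D lam u => f D lam u + a *: g D lam u).
Proof.
move=> [s sP] [t tP]; exists (s ++ [seq (a * p.1, p.2) | p <- t]) => D lam u.
rewrite big_cat sP tP scaler_sumr big_map; congr (_ + _).
by apply: eq_bigr => p _; rewrite scalerA.
Qed.

Lemma lin_comb_sum (I : finType) (P : pred I) (f : I -> label_map) :
  (forall i, P i -> lin_comb (f i)) ->
  lin_comb (fun D lam u => \sum_(i | P i) f i D lam u).
Proof.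
move=> fP; suff H (s : seq I) :
    lin_comb (fun D lam u => \sum_(i <- s | P i) f i D lam u).
  by apply: lin_comb_ext (H (index_enum I)).
elim: s => [|i s IH]; first by exists [::] => D lam u; rewrite !big_nil.
have [Pi|Pi] := boolP (P i); last first.
  by apply: lin_comb_ext IH => D lam u; rewrite big_cons (negbTE Pi).
apply: lin_comb_ext (lin_combD 1 (fP i Pi) IH) => D lam u.
by rewrite big_cons Pi scale1r.
Qed.

End LinearCombinations.

(** A merged vertex contributes the product of the transformations of its preimages. *)
Definition quotient_mu (d d' : nat) (V X : finType) (q : V -> X)
    (mu : V -> 'rV[R]_d -> 'rV[R]_d') : X -> 'rV[R]_d -> 'rV[R]_d' :=
  fun x y => \row_j \prod_(v | q v == x) mu v y 0 j.

(* A homomorphism is an embedding of the quotient by its kernel, enriched with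
   all facts that hold in its image. *)
Lemma hom_query_embs (d d' : nat) (q : query R S d d') :
  qagg q = @agg_sum R -> lin_comb embs (query_result homs q).
Proof.
case: q => F w mu agg /= ->; pose V : finType := pdom F.
pose vt (sT : {ffun V -> V} * {set vfact S V}) := @vert S V (val \o sT.1) sT.2.
(* Only types realised somewhere are summed over; by [type_of_emb] every embedding of their quotient
   has that very type, so no map is counted twice. *)
pose good sT := (`[< exists (D : database S) (h : V -> adom D),
    kernel h = sT.1 /\ diagram h = sT.2 >] &&
  [forall f : vfact S V, pholds f ==> (f \in sT.2)]).
pose qq (sT : {ffun V -> V} * {set vfact S V}) : sum_query d d' := existT _ (pat (val \o sT.1) sT.2)
  (vt sT w, quotient_mu (vt sT) mu).
have H := lin_comb_sum (P := good) (fun sT _ => lin_comb_query embs (qq sT)).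
apply: lin_comb_ext H => D lam u; apply/rowP => j.
rewrite summxE sum_query_resultE //=; symmetry.
pose type (h : {ffun V -> adom D}) := (kernel h, diagram h).
rewrite (partition_big type good) /= => [|h /homsP[hw hF]]; last first.
  apply/andP; split; first by apply/asboolP; exists D, h.
  by apply/forallP => f; apply/implyP => /hF; rewrite inE.
apply: eq_bigr => sT /andP[/asboolP[D0 [h0 [h0s h0T]]] /forallP FT].
rewrite sum_query_resultE //=.
rewrite (@sum_quotient V _ (adom D) (vt sT) _
  (fun h' => h' \in embs (vt sT w) u) (fun v a => mu v (lam a) 0 j)).
- apply: eq_bigr => h' _; apply: eq_bigr => x _.
  by rewrite mxE.
- exact: vert_surj.
- move=> h v v' /andP[_ /eqP <-] /(vert_quotE _ _ val_inj) e.
  exact/kernelP.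
move=> h'; apply/andP/idP => [[/homsP[hw _] /eqP hsT]|h'E].
  have [h'' h''E h''P] := @emb_of_type S V val sT.1 sT.2 val_inj D
    [ffun v => h' (vt sT v)] w (congr1 fst hsT) (congr1 snd hsT).
  suff -> : h' = h'' by rewrite -hw.
  apply/ffunP => x; have [v <-] := vert_surj x.
  by rewrite h''P ffunE.
have [ks dT] := type_of_emb val_inj h0s h0T h'E.
have vtE : [ffun v => h' (vt sT v)] =1 h' \o vt sT by move=> v; rewrite ffunE.
split.
  apply/homsP; split=> [|f Ff]; first by rewrite ffunE; have /embs_pat[] := h'E.
  have -> : fholds [ffun v => h' (vt sT v)] f = fholds (h' \o vt sT) f.
    by apply: eq_fholds => v _; exact: vtE.
  by apply: emb_quotient_hom h'E _; exact: (implyP (FT f)).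
rewrite /type -pair_eqE /=; apply/andP; split; apply/eqP.
  by apply: etrans ks; apply: eq_kernel => v v'; rewrite !vtE.
apply: etrans dT; apply/setP => f; rewrite !inE.
by apply: eq_fholds => v _; exact: vtE.
Qed.

Section Literals.
Variable V : finType.
Definition literal : Type := (vfact S V + V * V)%type.
Definition lit_holds (D : database S) (h : V -> adom D) (l : literal) : bool :=
  match l with inl f => fholds h f | inr (a, b) => h a == h b end.
End Literals.

Section Elimination.
Variables (d d' : nat) (F : pattern S) (w : pdom F)
  (mu : pdom F -> 'rV[R]_d -> 'rV[R]_d').
Let V : finType := pdom F.

(** [F] supplies only its vertices; facts, equalities and their negations are imposed through the
    literals. *)
Definition lit_query (pos neg : seq (literal V)) : label_map d d' :=
  fun D lam u => \row_j \sum_(h : {ffun V -> adom D} |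
      [&& h w == u, all (lit_holds h) pos & all (fun l => ~~ lit_holds h l) neg])
    \prod_v mu v (lam (h v)) 0 j.

(** Equalities are built in by merging each connected component of the graph [e] they span; positive
    facts become the facts of the quotient. *)
Lemma pos_lit_query (pos : seq (literal V)) : lin_comb homs (lit_query pos [::]).
Proof.
pose e : rel V := fun a b =>
  has (fun l => if l is inr p then (p == (a, b)) || (p == (b, a)) else false) pos.
have e_sym : connect_sym e.
  apply: sym_connect_sym => a b.
  by apply: eq_has => -[//|p]; rewrite orbC.
pose s := finfun (fingraph.root e).
pose T : {set vfact S V} :=
  [set f | has (fun l => if l is inl g then g == f else false) pos].
pose q := @vert S V (val \o s) T.
have qE v v' : q v = q v' <-> connect e v v'.
  rewrite (vert_quotE _ _ val_inj) /s !ffunE.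
  by split=> /(fingraph.rootP e_sym).
pose qq : sum_query d d' := existT _ (pat (val \o s) T) (q w, quotient_mu q mu).
have posP D (h : V -> adom D) : all (lit_holds h) pos <->
    (forall v v', connect e v v' -> h v = h v') /\ forall f, f \in T -> fholds h f.
  split=> [/allP H|[Hc HT]].
    have He v v' : e v v' -> h v = h v'.
      move=> /hasP[[//|p] pp] /orP[] /eqP pE; have := H _ pp; rewrite pE.
        by move/eqP.
      by move/eqP.
    split=> [v v' /connectP[p]|f].
      elim: p v => [|x p IH] v /= => [_ -> //|/andP[/He -> xp] lE].
      exact: IH.
    by rewrite inE => /hasP[[g|//] gp /eqP <-]; exact: (H (inl g)).
  apply/allP => -[f fp|[a b] ap] /=.
    by apply: HT; rewrite inE; apply/hasP; exists (inl f).
  apply/eqP/Hc/connect1/hasP; exists (inr (a, b)) => //.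
  by rewrite eqxx.
apply: lin_comb_ext (lin_comb_query homs qq) => D lam u; apply/rowP => j.
rewrite sum_query_resultE //= mxE; symmetry.
rewrite (@sum_quotient V _ (adom D) q _
  (fun h' => h' \in homs (q w) u) (fun v a => mu v (lam a) 0 j)).
- apply: eq_bigr => h' _; apply: eq_bigr => x _.
  by rewrite mxE.
- exact: vert_surj.
- move=> h v v' /and3P[_ /posP[Hc _] _] /qE; exact: Hc.
move=> h'.
have hE : [ffun v => h' (q v)] =1 h' \o q by move=> v; rewrite ffunE.
apply/and3P/homs_pat => [[/eqP hw /posP[_ HT] _]|[hw HT]].
  split=> [|f /HT]; first by rewrite -hw ffunE.
  by congr (is_true _); apply: eq_fholds => v _; rewrite hE.
split=> //; first by rewrite ffunE hw.
apply/posP; split=> [v v' /qE e'|f /HT]; first by rewrite !ffunE e'.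
by congr (is_true _); apply: eq_fholds => v _; rewrite hE.
Qed.

(* A negative literal l is eliminated by [not l] = 1 - [l]. *)
Lemma lin_comb_lit_query (pos neg : seq (literal V)) :
  lin_comb homs (lit_query pos neg).
Proof.
elim: neg pos => [|l neg IH] pos; first exact: pos_lit_query.
apply: lin_comb_ext (lin_combD (-1) (IH pos) (IH (l :: pos))) => D lam u.
apply/rowP => j; rewrite !mxE /= mulN1r.
rewrite (bigID (fun h : {ffun V -> adom D} => lit_holds h l)) /=.
rewrite [X in X + _ - _](eq_bigl (fun h : {ffun V -> adom D} =>
  [&& h w == u, lit_holds h l && all (lit_holds h) pos
    & all (fun l' => ~~ lit_holds h l') neg])).
  rewrite addrAC subrr add0r; apply: eq_bigl => h.
  by rewrite -!andbA; congr (_ && _); congr (_ && _); rewrite andbC.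
by move=> h; do ![case: (_ == _) => //=|case: (lit_holds _ _) => //=|case: (all _ _) => //=].
Qed.

End Elimination.

(** An embedding is a map given by literals: facts of [F] are positive, while missing facts and
    coincidences of distinct vertices are negative. *)
Lemma emb_query_homs (d d' : nat) (q : query R S d d') :
  qagg q = @agg_sum R -> lin_comb homs (query_result embs q).
Proof.
case: q => F w mu agg /= ->; pose V : finType := pdom F.
pose pos : seq (literal V) := [seq inl f | f : vfact S V in [pred f | pholds f]].
pose neg : seq (literal V) := [seq inl f | f : vfact S V in [pred f | ~~ pholds f]] ++
  [seq inr p | p : V * V in [pred p | p.1 != p.2]].
apply: lin_comb_ext (lin_comb_lit_query w mu pos neg) => D lam u.
apply/rowP => j; rewrite mxE sum_query_resultE //=; apply: eq_bigl => h.
apply/and3P/embsP => [[/eqP hw /allP hp /allP hn]|[hw hi hf]].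
  split=> // [v v' e|f].
    apply/eqP; apply: contraT => vv'.
    have /hn /= : inr (v, v') \in neg.
      by rewrite mem_cat; apply/orP; right; apply: image_f; rewrite inE.
    by rewrite e eqxx.
  have [pf|pf] := boolP (pholds f).
    by have /hp /= -> : inl f \in pos by apply: image_f; rewrite inE.
  have /hn /= /negbTE -> // : inl f \in neg.
  by rewrite mem_cat; apply/orP; left; apply: image_f; rewrite inE.
split; first exact/eqP.
  by apply/allP => _ /imageP[f fP ->]; rewrite /= -hf.
apply/allP => l; rewrite mem_cat => /orP[/imageP[f fP ->]|/imageP[[a b] ab ->]] /=.
  by rewrite -hf.
by apply: contra ab => /eqP/hi ->.
Qed.

Section Simulation.
Variables maps maps' : map_family.
Hypothesis simulate : forall (d d' : nat) (q : query R S d d'),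
  qagg q = @agg_sum R -> lin_comb maps' (query_result maps q).

(** The queries of all the linear combinations form one family, and the new combination function
    takes the linear combinations before applying the old one. *)
Lemma simulate_layer (d d' : nat) (L : layer R S d d') :
  (forall i, qagg (lquery L i) = @agg_sum R) ->
  exists2 L' : layer R S d d', (forall i, qagg (lquery L' i) = @agg_sum R) &
    forall D (lam : adom D -> 'rV[R]_d),
      layer_result maps' L' lam = layer_result maps L lam.
Proof.
move=> Lsum; have sP i := cid (simulate (Lsum i)).
pose s i := sval (sP i).
pose K : finType := {i : 'I_(nq L) & 'I_(size (s i))}.
pose p (k : K) := tnth (in_tuple (s (tag k))) (tagged k).
exists (@fin_layer R S d d' K (fun k => qdim L (tag k)) (fun k => qdim_gt0 (tag k))
  (fun k => to_query (p k).2)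
  (fun g => com L (fun i => \sum_(m < size (s i))
     ((p (existT _ i m)).1 *: g (existT _ i m) : 'rV[R]_(qdim L i))))).
  exact: fin_layer_agg.
move=> D lam; apply: funext => u; rewrite fin_layerE; congr com.
apply: functional_extensionality_dep => i.
by rewrite (svalP (sP i)) (big_tnth _ _ (s i)).
Qed.

Lemma simulate_network (d : nat) (N : network R S d) : uses_only (@agg_sum R) N ->
  exists2 N' : network R S d, uses_only (@agg_sum R) N' &
    forall D (lam : adom D -> 'rV[R]_d), run maps' N' lam = run maps N lam.
Proof.
elim: N => {d} [d cls|d d' L N IH] /=; first by exists (NCls S cls).
move=> [/simulate_layer[L' L's L'E] /IH[N' N's N'E]].
by exists (NLayer L' N') => //= D lam; rewrite N'E L'E.
Qed.

End Simulation.
End SumNetworks.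

(** * Translations between the classes of classifiers *)

Definition expressed_by (S : schema) (P : pointed_db S -> Prop) (e : emf S) : Prop :=
  forall Dv : pointed_db S, esat (pt Dv) e <-> P Dv.

Lemma uqafo_emf (S : schema) (P : pointed_db S -> Prop) :
  expressible UQAFO P -> exists e, expressed_by P e.
Proof.
move=> [[f [fu [x fx]]] fP]; have [e eP] := uqafo_emdef fu fx.
by exists e => Dv; rewrite eP -fP.
Qed.

Lemma emf_EML (S : schema) (P : pointed_db S -> Prop) e :
  expressed_by P e -> expressible EML P.
Proof.
move=> eP; have [f f0 fE] := emf_eml e 0%N.
by exists (exist _ f (ex_intro _ 0%N f0)) => Dv; rewrite -eP /= /faccepts fE.
Qed.

Lemma EML_uqafo (S : schema) (P : pointed_db S -> Prop) :
  expressible EML P -> expressible UQAFO P.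
Proof.
move=> [[f [x fx]] fP]; have [g [gE gx gP]] := (@eml_uq S).1 x f fx.
exists (exist _ g (conj (uqEx gE) (ex_intro _ x gx))) => Dv.
by rewrite -fP /= /faccepts gP.
Qed.

Lemma emf_DEN (R : realType) (agg : aggregation R) (S : schema)
    (P : pointed_db S -> Prop) e :
  detects agg -> expressed_by P e -> expressible (DEN agg) P.
Proof.
move=> aggP eP; have [N Nagg NP] := emf_network aggP e.
by exists (exist _ N Nagg) => Dv; rewrite -eP /= NP.
Qed.

Lemma max_DEN_emf (R : realType) (S : schema) (P : pointed_db S -> Prop) :
  expressible (DEN (@agg_max R)) P -> exists e, expressed_by P e.
Proof.
move=> [[N Nmax] NP]; have [e eP] := max_network_emdef (@emdef_emb S) Nmax.
by exists e => Dv; rewrite eP -NP.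
Qed.

Lemma max_DHN_emf (R : realType) (S : schema) (P : pointed_db S -> Prop) :
  expressible (DHN (@agg_max R)) P -> exists e, expressed_by P e.
Proof.
move=> [[N Nmax] NP]; have [e eP] := max_network_emdef (@emdef_hom S) Nmax.
by exists e => Dv; rewrite eP -NP.
Qed.

Lemma sum_DEN_DHN (R : realType) :
  same_expressive_power (DEN (@agg_sum R)) (DHN (@agg_sum R)).
Proof.
split=> S P [[N Nsum] NP].
  have [N' N's N'P] := simulate_network (@hom_query_embs R S) Nsum.
  by exists (exist _ N' N's) => Dv; rewrite -NP /= /naccepts N'P.
have [N' N's N'P] := simulate_network (@emb_query_homs R S) Nsum.
by exists (exist _ N' N's) => Dv; rewrite -NP /= /naccepts N'P.
Qed.

(** * Separations *)

Section UnarySchema.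

Definition unary : schema := @Schema unit (fun=> 1%N).

(* Since every value of a database over this schema satisfies the only
   predicate, such a database is a bare finite set. *)
Lemma unary_fholds (V : Type) (D : database unary) (h : V -> adom D)
    (f : vfact unary V) : fholds h f.
Proof.
rewrite /fholds; case: f => [[] t]; rewrite /relabel /=.
have [[[] t'] t'D] := mem_adom D _ (valP (h (tnth t ord0))).
rewrite /= => ht; suff -> : map_tuple (fun v => val (h v)) t = t' by [].
have i0 (i : 'I_1) : i = ord0 by apply: val_inj; rewrite ord1.
apply: eq_from_tnth => i; transitivity (val (h (tnth t ord0))).
  by rewrite tnth_map (i0 i).
by have /tnthP[k e] := ht; apply: etrans e _; rewrite (i0 i) (i0 k).
Qed.

Definition unary_db (n : nat) : database unary :=
  [fset (existT _ tt [tuple i] : fact unary) | i in iota 0 n].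

Lemma adom_unary_db n : adom (unary_db n) = [fset i in iota 0 n].
Proof.
apply/fsetP => x; rewrite in_fset; apply/mem_adom/idP => [[f]|xn].
  by move=> /imfsetP[i /= i_n ->]; rewrite inE => /eqP ->.
exists (existT _ tt [tuple x]); last by rewrite inE.
by apply/imfsetP; exists x.
Qed.

Lemma card_unary_db n : #|{: adom (unary_db n)}| = n.
Proof.
rewrite -cardfE adom_unary_db card_fseq undup_id ?iota_uniq //.
exact: size_iota.
Qed.

Lemma unary_db_point n : (0 < n)%N ->
  exists Dv : pointed_db unary, #|{: adom (db Dv)}| = n.
Proof.
move=> n0; have : (0 < #|{: adom (unary_db n)}|)%N by rewrite card_unary_db.
by move=> /card_gt0P[u _]; exists (PointedDb u); exact: card_unary_db.
Qed.

(** Any injection, followed by the transposition that moves the image of [v] to [a]. *)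
Lemma injection_through (V A : finType) (v : V) (a : A) : (#|V| <= #|A|)%N ->
  exists2 h : V -> A, injective h & h v = a.
Proof.
move=> VA; pose k x := enum_val (widen_ord VA (enum_rank x)).
have k_inj : injective k.
  move=> x y /enum_val_inj /(congr1 val) /= e.
  exact/enum_rank_inj/val_inj.
exists (fun x => tperm (k v) a (k x)) => [x y /perm_inj/k_inj //|].
by rewrite tpermL.
Qed.

(** Above the thresholds of its labels and the size of [F], an embedding exists exactly when [F] has
    all facts over its vertices and all its labels are eventually true; neither condition depends on
    the database. *)
Lemma unary_emf_threshold (e : emf unary) : exists (n : nat) (b : bool),
  forall (D : database unary) (u : adom D), (n <= #|{: adom D}|)%N -> esat u e = b.
Proof.
elim: e => [|e [n [b eb]]|e1 [n [b eb]] e2 [n' [b' eb']]|F w l IH].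
- by exists 0%N, true.
- by exists n, (~~ b) => D u /eb /= ->.
- exists (maxn n n'), (b || b') => D u; rewrite geq_max => /andP[nD n'D] /=.
  by rewrite eb // eb'.
have /choice[nb nbP] : forall v, exists nb : nat * bool, forall (D : database unary)
    (u : adom D), (nb.1 <= #|{: adom D}|)%N -> esat u (l v) = nb.2.
  by move=> v; have [n [b H]] := IH v; exists (n, b).
exists (maxn #|{: pdom F}| (\max_v (nb v).1)).
exists ([forall f : vfact unary (pdom F), pholds f] && [forall v, (nb v).2]).
move=> D u; rewrite geq_max => /andP[FD /bigmax_leqP nD] /=.
apply/exists_inP/andP => [[h /embsP[_ _ hf] /forallP hl]|[/forallP Ff /forallP lb]].
  split; apply/forallP; first by move=> f; rewrite hf unary_fholds.
  by move=> v; rewrite -(nbP v D (h v)) ?nD.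
have [h h_inj hw] := injection_through w u FD.
exists (finfun h); last by apply/forallP => v; rewrite nbP ?nD.
apply/embsP; split=> [|x y|f]; first by rewrite ffunE.
  by rewrite !ffunE => /h_inj.
by rewrite Ff unary_fholds.
Qed.

Definition odd_size (Dv : pointed_db unary) : Prop := odd #|{: adom (db Dv)}|.

Lemma odd_size_not_emf e : ~ expressed_by odd_size e.
Proof.
move=> eP; have [n [b nb]] := unary_emf_threshold e.
have [Dv Dn] := @unary_db_point n.*2.+1 isT.
have [Dv' Dn'] := @unary_db_point n.*2.+2 isT.
have lt2 : (n <= n.*2)%N by rewrite -addnn leq_addr.
have := eP Dv; have := eP Dv'; rewrite /odd_size Dn Dn' /= odd_double /=.
rewrite (nb _ (pt Dv)) ?Dn 1?leqW // (nb _ (pt Dv')) ?Dn' 1?leqW 1?leqW //.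
by move=> [H _] [_ H']; have := H (H' isT).
Qed.

(** The pattern has the root and one isolated vertex. Its homomorphisms number a positive power of
    the size of the active domain, which has the same parity as that size. *)
Lemma odd_size_sum_DHN (R : realType) : expressible (DHN (@agg_sum R)) odd_size.
Proof.
pose F := pat (val : 'I_2 -> nat) (set0 : {set vfact unary 'I_2}).
pose w : pdom F := vert (val : 'I_2 -> nat) set0 ord0.
pose q : query R unary 0 1 := Query w (fun _ _ => const_mx 1) (@agg_sum R).
pose L := fin_layer (fun i : unit => isT : (0 < 1)%N) (fun=> q) (fun g => g tt).
pose N := NLayer L (NCls unary (fun y : 'rV[R]_1 => `[< exists2 n, odd n & y 0 0 = n%:R >])).
have Nsum : uses_only (@agg_sum R) N by split=> //; exact: fin_layer_agg.
exists (exist _ N Nsum) => -[D u].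
have LE : layer_result homs L (fun _ : adom D => 0) u 0 0 = #|homs w u|%:R.
  rewrite /L fin_layerE sum_query_resultE //= -sumr_const; apply: eq_bigr => h _.
  by rewrite big1 // => v _; rewrite mxE.
rewrite /= /naccepts /= LE.
have -> : #|homs w u| = (#|{: adom D}| ^ #|[pred v : pdom F | v != w]|)%N.
  pose G (v : pdom F) : pred (adom D) := if v == w then pred1 u else predT.
  rewrite (@eq_card _ _ (mem (family G))) => [|h].
    rewrite card_family foldrE big_map big_enum (bigD1 w) //= {1}/G eqxx card1 mul1n.
    rewrite (eq_bigr (fun=> #|{: adom D}|)) ?prod_nat_const // => v /negbTE vw.
    by rewrite /G vw; apply: eq_card.
  apply/homs_pat/familyP => [[hw _] v|hG].
    by rewrite /G; case: eqP => [->|_] //; rewrite inE hw.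
  by split=> [|f]; [have := hG w; rewrite /G eqxx => /eqP|rewrite inE].
have w_lt : (0 < #|[pred v : pdom F | v != w]|)%N.
  by apply/card_gt0P; exists (vert val set0 ord_max); rewrite inE.
have -> : odd_size (PointedDb u) = odd (#|{: adom D}| ^ #|[pred v : pdom F | v != w]|)%N.
  by rewrite oddX /odd_size /= eqn0Ngt w_lt.
split=> [/asboolP[n n_odd /eqP]|n_odd]; first by rewrite eqr_nat => /eqP ->.
by apply/asboolP; eexists; first exact: n_odd.
Qed.

(** From a constant labeling all homomorphisms have the same value, and the constant map to [u0] is
    one of them. Each maximum is therefore that value, and the labeling stays constant with a
    constant independent of the database. *)
Lemma max_DHN_unary (R : realType) (d : nat) (N : network R unary d) (c : 'rV[R]_d)
    (D D' : database unary) (u : adom D) (u' : adom D') :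
  uses_only (@agg_max R) N -> run homs N (fun=> c) u = run homs N (fun=> c) u'.
Proof.
elim: N c => {d} [//|d d' L N IH] c /= [Lmax Nmax].
pose c' := com L (fun i => \row_j agg_max (seq_mset
  [:: \prod_v qmu (q := lquery L i) v c 0 j])).
suff LE D0 : layer_result homs L (fun _ : adom D0 => c) = (fun=> c').
  by rewrite !LE; exact: IH.
apply: funext => u0; rewrite /layer_result; congr com.
apply: functional_extensionality_dep => i; apply/rowP => j; rewrite !mxE Lmax.
apply: eq_agg_max => x; rewrite inE; apply/imageP/eqP => [[h _ -> //]|->].
exists [ffun=> u0] => //; apply/homsP; split; first by rewrite ffunE.
by move=> f _; exact: unary_fholds.
Qed.

Definition two_values (Dv : pointed_db unary) : Prop := (1 < #|{: adom (db Dv)}|)%N.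

Lemma two_values_EML : expressible EML two_values.
Proof.
pose f : fo unary := foldr (@Ex unary) (Neg (Eql 0%N 1%N)) [:: 1%N].
have f0 : eml 0%N f by apply/emEx/ecNeq; rewrite !inE.
exists (exist _ f (ex_intro _ 0%N f0)) => -[D u] /=.
rewrite /two_values /faccepts /= /upd /=; split=> [/existsP[v uv]|].
  by rewrite (cardD1 u) (cardD1 v) !inE eq_sym uv.
rewrite (cardD1 u) inE add1n ltnS => /card_gt0P[v]; rewrite !inE andbT => vu.
by apply/existsP; exists v; rewrite eq_sym.
Qed.

Lemma two_values_not_max_DHN (R : realType) :
  ~ expressible (DHN (@agg_max R)) two_values.
Proof.
move=> [[N Nmax] NP].
have [Dv D1] := @unary_db_point 1 isT; have [Dv' D2] := @unary_db_point 2 isT.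
have := NP Dv; have := NP Dv'; rewrite /two_values D1 D2 /= /naccepts.
rewrite (max_DHN_unary 0 (pt Dv) (pt Dv') Nmax) => [[_ H] [H' _]].
by have := H' (H isT).
Qed.

End UnarySchema.

Theorem theorem12 (R : realType) :
  (same_expressive_power UQAFO EML /\
   same_expressive_power EML (DEN (@agg_max R)) /\
   same_expressive_power UQAFO (DEN (@agg_max R))) /\
  strictly_more_expressive (DEN (@agg_sum R)) UQAFO /\
  same_expressive_power (DEN (@agg_sum R)) (DHN (@agg_sum R)) /\
  strictly_more_expressive (DEN (@agg_max R)) (DHN (@agg_max R)).
Proof.
have EML_emf S (P : pointed_db S -> Prop) : expressible EML P -> exists e, expressed_by P e.
  by move=> /EML_uqafo/uqafo_emf.
have emf_max S (P : pointed_db S -> Prop) e := @emf_DEN R _ S P e (@detects_max R).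
have emf_sum S (P : pointed_db S -> Prop) e := @emf_DEN R _ S P e (@detects_sum R).
split; [split; [|split]; split=> S P|split; [|split]].
- exact: EML_uqafo.
- by move=> /uqafo_emf[e /emf_EML].
- by move=> /max_DEN_emf[e /emf_EML].
- by move=> /EML_emf[e /emf_max].
- by move=> /max_DEN_emf[e /emf_EML/EML_uqafo].
- by move=> /uqafo_emf[e /emf_max].
- split=> [S P /uqafo_emf[e /emf_sum] //|]; exists unary, odd_size; split.
    exact: (sum_DEN_DHN R).1 _ _ (odd_size_sum_DHN R).
  by move=> /uqafo_emf[e /odd_size_not_emf].
- exact: sum_DEN_DHN.
- split=> [S P /max_DHN_emf[e /emf_max] //|]; exists unary, two_values; split.
    by have [e /emf_max] := EML_emf _ _ two_values_EML.
  exact: two_values_not_max_DHN.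
Qed.
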